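(* Let $d\ge1$ and let $F$ be an aperiodic probability distribution on $\mathbb{Z}^d$. Let $(X_\ell,\,\ell\in\mathbb{N}^* )$ be independent random variables with the same distribution $F$, and let $S_n=\sum_{\ell=1}^nX_\ell$ for $n\in\mathbb{N}^*$. Let $(s_n,\,n\in\mathbb{N}^* )$ be a sequence of elements of $\mathbb{Z}^d$ satisfying: (a) $\sup_{n\in\mathbb{N}^*}\left|\frac{s_n}{n}\right|<\infty$; (b) $\lim_{n\to\infty}\psi\left(\frac{s_n}{n}\right)=0$. Then for all $m\in\mathbb{N}$ and $b\in\mathbb{Z}^d$, $$\lim_{n\to\infty}\frac{\mathbb{P}(S_{n-m}=s_n-b)}{\mathbb{P}(S_n=s_n)}=1.$$
   Context: $\mathbb N=\{0,1,\dots\}$, $\mathbb N^*=\{1,2,\dots\}$; $|x|=\sum_i|x_i|$ for $x\in\mathbb R^d$. A probability distribution $F$ on $\mathbb{Z}^d$ is aperiodic if the smallest subgroup of $\mathbb{Z}^d$ containing $\mathrm{supp}(F)-\mathrm{supp}(F)=\{x-y:x,y\in\mathrm{supp}(F)\}$ is $\mathbb{Z}^d$, where $\mathrm{supp}(F)=\{x\in\mathbb{Z}^d:F(x)>0\}$. For $X$ with distribution $F$, the log-Laplace transform is $\varphi(\theta)=\log\mathbb{E}[e^{\langle\theta,X\rangle}]\in(-\infty,+\infty]$, $\theta\in\mathbb{R}^d$, with domain $\mathrm{dom}(\varphi)=\{\theta:\varphi(\theta)<\infty\}$, and its conjugate is $\psi(x)=\sup_{\theta\in\mathrm{dom}(\varphi)}(\langle\theta,x\rangle-\varphi(\theta))\in[0,+\infty]$,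 $x\in\mathbb{R}^d$. *)

(* Defs.v *)
From HB Require Import structures.
From mathcomp Require Import all_boot all_order all_algebra finmap.
From mathcomp Require Import all_classical all_reals all_analysis.

Set Implicit Arguments.
Unset Strict Implicit.
Unset Printing Implicit Defensive.

Import Order.TTheory GRing.Theory Num.Theory.
Import numFieldNormedType.Exports.

Local Open Scope classical_set_scope.
Local Open Scope ring_scope.

(* Z^d with its discrete sigma-algebra. An alias is needed because row vectors
   carry no measurable structure in the library. *)
Definition Zd (d : nat) : Type := 'rV[int]_d.

HB.instance Definition _ (d : nat) := GRing.Zmodule.on (Zd d).
HB.instance Definition _ (d : nat) := isPointed.Build (Zd d) 0.
HB.instance Definition _ (d : nat) :=
  @isMeasurable.Build default_measure_display (Zd d) discrete_measurable
    discrete_measurable0 discrete_measurableC discrete_measurableU.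

Definition Zd_to_Rd (R : realType) (d : nat) (x : Zd d) : 'rV[R]_d :=
  map_mx intr (x : 'rV[int]_d).

(* The library norm on row vectors is the max norm. *)
Definition norm1 (R : realType) (d : nat) (x : 'rV[R]_d) : R :=
  \sum_(i < d) `|x 0 i|.

Definition inner (R : realType) (d : nat) (x y : 'rV[R]_d) : R :=
  \sum_(i < d) x 0 i * y 0 i.

Section Distribution.
Variables (R : realType) (d : nat) (F : probability (Zd d) R).

Definition supp : set (Zd d) := [set x | (0 < F [set x])%E].

Definition is_subgroup (H : set (Zd d)) : Prop :=
  H 0 /\ forall x y, H x -> H y -> H (x - y).

Definition aperiodic : Prop :=
  smallest is_subgroup [set x - y | x in supp & y in supp] = [set: Zd d].

Definition log_laplace (theta : 'rV[R]_d) : \bar R :=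
  lne ('E_F[fun x : Zd d => expR (inner theta (Zd_to_Rd R x))])%E.

Definition dom_log_laplace : set 'rV[R]_d :=
  [set theta | (log_laplace theta < +oo)%E].

Definition conjugate (x : 'rV[R]_d) : \bar R :=
  ereal_sup [set ((inner theta x)%:E - log_laplace theta)%E
            | theta in dom_log_laplace].

End Distribution.

(* Mutual independence of the subfamily of X indexed by D. *)
Definition independent_RVs (dT dE : measure_display) (T : measurableType dT)
    (E : measurableType dE) (R : realType) (P : probability T R)
    (I : choiceType) (D : set I) (X : I -> {RV P >-> E}) : Prop :=
  forall (J : {fset I}) (A : I -> set E),
    [set` J] `<=` D ->
    (forall i, i \in J -> measurable (A i)) ->
    P (\bigcap_(i in [set` J]) (X i @^-1` A i)) =
    (\prod_(i <- J) P (X i @^-1` A i))%E.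

Definition partial_sum (T : Type) (d : nat) (X : nat -> T -> Zd d) (n : nat)
    (t : T) : Zd d :=
  \sum_(1 <= l < n.+1) X l t.

(* Main.v *)
Require Import Defs.
From mathcomp Require Import all_boot all_order all_algebra finmap.
From mathcomp Require Import all_classical all_reals all_analysis.
From mathcomp Require Import ring lra zify.
Import Order.TTheory GRing.Theory Num.Theory.
Import numFieldNormedType.Exports.
Local Open Scope classical_set_scope.
Local Open Scope ring_scope.

(** Write p n y for P(S_n = y).

    The ratio of two neighbouring probabilities is controlled by the law of large
    numbers. Given S_(n+1) = y + x, the conditional mean of the frequency of the
    step x among the n+1 exchangeable steps is F(x) p n y / p (n+1) (y+x).
    Without conditioning, this frequency differs from F(x) by more than a fixed
    amount with exponentially small probability only. Hence the ratio is close
    to 1 wherever p (n+1) (y+x) is not exponentially small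
    ([walk_law_step], [ratio_step]). Such comparisons can be chained along words
    of steps, and aperiodicity says that every (m, b) is a difference of two
    words ([aperiodic_words], [ratio_limit]).

    It remains to see that p n (s n) is not exponentially small
    ([walk_law_subexp]). As F need not have any moment, this is done by convex
    duality. The triples (r, k, z) with p k z >= e^-r form a semigroup, because p
    is supermultiplicative. Let x be a limit point of s n / n, so that the
    conjugate of the log-Laplace transform vanishes at x. If the direction
    (eps, 1, x) were not interior to the cone of the semigroup, a hyperplane
    would separate them, that is p k z <= e^(-a k - <theta, z>) for all k and z,
    with <theta, x> + a > 0. The k-th convolution power is spread over
    polynomially many points in a given box, so this bound for all k forces the
    log-Laplace transform at theta to be at most -a, less than <theta, x>: a
    contradiction ([tilted_mass_le], [affordable_dual]). Vertical hyperplanes are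
    excluded by aperiodicity ([laplace_strict]).

    Once the direction is interior, sums of elements of bounded size of
    the semigroup follow n (eps, 1, s n / n) within bounded distance: the residual
    can always be shortened by a suitable element ([uniform_margin], [greedy]).
    The bounded error, a lattice point, is corrected at bounded cost
    ([walk_law_reserve]). Therefore p n (s n) >= c e^(-n eps).

    Infinite sums over the lattice are avoided throughout: the law of S_n is the
    limit of convolution powers over finite alphabets
    ([partial_sum_walk_law]). *)

(** * Convolution powers over a finite alphabet *)

Section Convolution.
Context {R : realType} {V : zmodType}.
Implicit Types (F : V -> R) (A : seq V) (y s t : V).

(** The n-fold convolution power of the weights [F] restricted to the finite
    alphabet [A]. Working with a finite alphabet replaces every infinite sum
    over the lattice by a finite one; the law of the walk is recovered in the
    limit of larger and larger alphabets. *)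
Fixpoint conv_pow F A (n : nat) y : R :=
  if n is n'.+1 then \sum_(a <- A) F a * conv_pow F A n' (y - a)
  else (y == 0)%:R.

Lemma conv_pow_ge0 F A n y : (forall x, 0 <= F x) -> 0 <= conv_pow F A n y.
Proof.
move=> F0; elim: n y => [|n IHn] y /=; first exact: ler0n.
by apply: sumr_ge0 => a _; rewrite mulr_ge0.
Qed.

Lemma eq_perm_conv_pow F A A' n y :
  perm_eq A A' -> conv_pow F A n y = conv_pow F A' n y.
Proof.
move=> AA'; elim: n y => [//|n IHn] y /=.
by rewrite (perm_big _ AA'); apply: eq_bigr => a _; rewrite IHn.
Qed.

Lemma conv_pow_le_mass F A n y :
  (forall x, 0 <= F x) -> conv_pow F A n y <= (\sum_(a <- A) F a) ^+ n.
Proof.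
move=> F0; elim: n y => [|n IHn] y /=; first by rewrite expr0 lern1 leq_b1.
rewrite exprS mulr_suml; apply: ler_sum => a _.
by rewrite ler_wpM2l.
Qed.

Lemma conv_pow_supermult F A m n s t : (forall x, 0 <= F x) ->
  conv_pow F A m s * conv_pow F A n t <= conv_pow F A (m + n) (s + t).
Proof.
move=> F0; elim: n t => [|n IHn] t /=.
  rewrite addn0; have [->|_] := eqVneq t 0; first by rewrite addr0 mulr1.
  by rewrite mulr0 conv_pow_ge0.
rewrite addnS /= mulr_sumr; apply: ler_sum => a _.
by rewrite mulrCA ler_wpM2l// -addrA.
Qed.

(** Pascal's rule: the two operators, shifting by [x] with weight [F x] and
    convolving with the rest of the alphabet, commute, so that the n-th power of
    their sum expands by the binomial theorem. The index [j] counts how often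
    the step [x] is made. *)
Lemma conv_pow_cons F x A n y :
  conv_pow F (x :: A) n y =
  \sum_(j < n.+1) 'C(n, j)%:R * F x ^+ j * conv_pow F A (n - j) (y - x *+ j).
Proof.
elim: n y => [|n IHn] y.
  by rewrite big_ord_recl big_ord0 bin0 expr0 mulr0n subr0 !mul1r addr0.
rewrite [LHS]/= big_cons IHn.
under [X in _ + X = _]eq_bigr do rewrite IHn mulr_sumr.
rewrite exchange_big [RHS]big_ord_recl.
have pascal (j : 'I_n.+1) : true ->
    'C(n.+1, lift ord0 j)%:R * F x ^+ lift ord0 j
      * conv_pow F A (n.+1 - lift ord0 j) (y - x *+ lift ord0 j) =
    'C(n, j)%:R * F x ^+ j.+1 * conv_pow F A (n - j) (y - x *+ j.+1) +
    'C(n, j.+1)%:R * F x ^+ j.+1 * conv_pow F A (n - j) (y - x *+ j.+1).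
  by move=> _; rewrite lift0 binS natrD subSS addrC !mulrDl.
rewrite (eq_bigr _ pascal) big_split mulr_sumr [RHS]addrCA; congr +%R.
  by apply: eq_bigr => j _; rewrite exprS mulrS opprD addrA; ring.
rewrite [in RHS]big_ord_recr /= (bin_small (ltnSn n)) !mul0r addr0.
rewrite [LHS]big_ord_recl; congr +%R.
  rewrite /= !subn0 !bin0 !expr0 !mul1r mulr0n !subr0 /=.
  by apply: eq_bigr => a _; rewrite mul1r subr0.
apply: eq_bigr => j _; rewrite lift0.
have -> : (n - j = (n - j.+1).+1)%N by rewrite subnSK.
rewrite /= mulr_sumr; apply: eq_bigr => a _; rewrite [y - _ - _]addrAC.
ring.
Qed.

End Convolution.

(** * Concentration of the frequency of a step *)

(** Exchangeability of the steps, in the form j C(n+1, j) = (n+1) C(n, j-1):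
    reaching [y + x] with a prescribed last step [x] costs the average, over all
    ways of reaching [y + x], of the frequency of [x] among the n+1 steps. *)
Lemma conv_pow_size_bias {R : realType} {V : zmodType} (F : V -> R) x A n y :
  F x * conv_pow F (x :: A) n y =
  \sum_(j < n.+2) j%:R / n.+1%:R *
    ('C(n.+1, j)%:R * F x ^+ j * conv_pow F A (n.+1 - j) (y + x - x *+ j)).
Proof.
rewrite [RHS]big_ord_recl /= mul0r mul0r add0r conv_pow_cons mulr_sumr.
apply: eq_bigr => j _; rewrite (_ : bump 0 j = j.+1)// subSS.
have -> : y + x - x *+ j.+1 = y - x *+ j.
  by rewrite mulrSr opprD addrACA subrr addr0.
have -> : 'C(n, j)%:R = j.+1%:R / n.+1%:R * 'C(n.+1, j.+1)%:R :> R.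
  apply: (mulfI (_ : n.+1%:R != 0 :> R)); first by rewrite pnatr_eq0.
  rewrite -natrM (mul_bin_diag n.+1 j) natrM mulrA; congr (_ * _).
  by rewrite mulrC divfK// pnatr_eq0.
by rewrite exprS; ring.
Qed.

Section Chernoff.
Context {R : realType}.
Implicit Types (f u delta kappa : R).

Lemma binomial_mgf_le f u N : 0 <= f <= 1 ->
  \sum_(j < N.+1) 'C(N, j)%:R * f ^+ j * (1 - f) ^+ (N - j) * expR (u * j%:R)
  <= expR (N%:R * f * (expR u - 1)).
Proof.
move=> /andP[f0 f1].
rewrite (_ : \sum_(_ < _) _ = (1 - f + f * expR u) ^+ N); last first.
  rewrite exprDn; apply: eq_bigr => j _.
  rewrite exprMn -expRM_natr -mulr_natl; ring.
rewrite -mulrA [N%:R * _]mulrC expRM_natr lerXn2r ?nnegrE ?expR_ge0//.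
  by rewrite addr_ge0 ?mulr_ge0 ?expR_ge0// subr_ge0.
by apply: le_trans (expR_ge1Dx _); rewrite mulrBr mulr1; lra.
Qed.

(** Outside the window of relative width [delta] around [f], where the
    deviation is at most 1, one of the two exponentials is at least 1. Having
    this pointwise lets the Chernoff bound apply to every weighted sum over [j]
    without splitting its range. *)
Lemma frequency_deviation_le f u delta (N j : nat) :
  0 <= f <= 1 -> 0 < u -> 0 <= delta -> (0 < N)%N -> (j <= N)%N ->
  `|j%:R / N%:R - f| <= delta * f
     + expR (- (u * (N%:R * f * (1 + delta)))) * expR (u * j%:R)
     + expR (u * (N%:R * f * (1 - delta))) * expR (- u * j%:R).
Proof.
move=> /andP[f0 f1] u0 delta0 N0 jN.
rewrite -!expRD.
have NR : 0 < N%:R :> R by rewrite ltr0n.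
have r1 : j%:R / N%:R <= 1 :> R by rewrite ler_pdivrMr// mul1r ler_nat.
have r0 : 0 <= j%:R / N%:R :> R by rewrite divr_ge0.
have jE : j%:R = N%:R * (j%:R / N%:R) :> R by rewrite mulrC divfK// gt_eqF.
have df : 0 <= delta * f by rewrite mulr_ge0.
set E1 := expR _; set E2 := expR _.
have E10 : 0 <= E1 by exact: expR_ge0.
have E20 : 0 <= E2 by exact: expR_ge0.
set r := j%:R / N%:R in r0 r1 jE *.
have [hi|hi] := leP (f * (1 + delta)) r.
  have : 1 <= E1.
    rewrite -expR0 ler_expR addrC subr_ge0 ler_pM2l// -mulrA jE.
    by rewrite ler_pM2l.
  by rewrite ler_norml => ?; lra.
have [lo|lo] := leP r (f * (1 - delta)).
  have : 1 <= E2.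
    rewrite -expR0 ler_expR mulNr subr_ge0 ler_pM2l// -mulrA jE.
    by rewrite ler_pM2l.
  by rewrite ler_norml => ?; lra.
by rewrite ler_norml; lra.
Qed.

(** Both exponents are negative for small [u], since e^u = 1 + u + O(u^2). The
    choice u = delta / 4 is checked through e^u <= 1 / (1 - u) and
    e^-u <= 1 / (1 + u). *)
Lemma chernoff_rate delta : 0 < delta <= 1 -> exists u kappa,
  [/\ 0 < u, 0 < kappa, expR u - 1 - u * (1 + delta) <= - kappa
    & expR (- u) - 1 + u * (1 - delta) <= - kappa].
Proof.
move=> /andP[d0 d1]; pose u := delta / 4.
have u0 : 0 < u by rewrite /u; lra.
have u1 : u < 1 by rewrite /u; lra.
have hi : expR u - 1 - u * (1 + delta) < 0.
  have : expR u <= (1 - u)^-1.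
    rewrite -[expR u]invrK -expRN lef_pV2 ?posrE ?expR_gt0 ?subr_gt0//.
    exact: expR_ge1Dx.
  rewrite -[_^-1]mul1r ler_pdivlMr ?subr_gt0// => h.
  rewrite -(pmulr_llt0 _ (_ : 0 < 1 - u)) ?subr_gt0//.
  have : u = delta / 4 by []. nra.
have lo : expR (- u) - 1 + u * (1 - delta) < 0.
  have : expR (- u) <= (1 + u)^-1.
    rewrite expRN lef_pV2 ?posrE ?expR_gt0 ?addr_gt0//; exact: expR_ge1Dx.
  rewrite -[_^-1]mul1r ler_pdivlMr ?addr_gt0// => h.
  rewrite -(pmulr_llt0 _ (_ : 0 < 1 + u)) ?addr_gt0//.
  have : u = delta / 4 by []. nra.
exists u, (Num.min (- (expR u - 1 - u * (1 + delta)))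
                   (- (expR (- u) - 1 + u * (1 - delta)))).
by split; rewrite // ?lt_min ?oppr_gt0 ?hi ?lo// lerNr ge_min lexx ?orbT.
Qed.

(** By size biasing, the difference is the mean of the deviation of the
    frequency of [x] from [F x]. Large deviations are estimated after forgetting
    the endpoint: the remaining steps have total mass at most 1 - F x, which
    turns the weights into at most those of a binomial law. *)
Lemma conv_pow_step {V : zmodType} (F : V -> R) x A n y u delta kappa :
  (forall z, 0 <= F z) -> F x + \sum_(a <- A) F a <= 1 ->
  0 < u -> 0 <= delta ->
  expR u - 1 - u * (1 + delta) <= - kappa ->
  expR (- u) - 1 + u * (1 - delta) <= - kappa ->
  F x * `|conv_pow F (x :: A) n y - conv_pow F (x :: A) n.+1 (y + x)|
  <= F x * (delta * conv_pow F (x :: A) n.+1 (y + x))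
     + 2 * expR (- (n.+1%:R * F x * kappa)).
Proof.
move=> F0 mass u0 d0 hi lo.
set f := F x; set N := n.+1.
have mA0 : 0 <= \sum_(a <- A) F a by exact: sumr_ge0.
have f01 : 0 <= f <= 1 by rewrite F0 /= /f; lra.
have /andP[f0 f1] := f01.
pose w j := 'C(N, j)%:R * f ^+ j * conv_pow F A (N - j) (y + x - x *+ j).
have w0 j : 0 <= w j by rewrite !mulr_ge0 ?exprn_ge0 ?conv_pow_ge0.
pose v j := 'C(N, j)%:R * f ^+ j * (1 - f) ^+ (N - j).
have wv j : w j <= v j.
  rewrite ler_wpM2l ?mulr_ge0 ?exprn_ge0//.
  apply: le_trans (conv_pow_le_mass _ _ _ _ F0) _.
  by apply: lerXn2r; rewrite ?nnegrE /f; lra.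
rewrite -[f in f * `|_|]ger0_norm// -normrM mulrBr conv_pow_size_bias.
have -> : conv_pow F (x :: A) N (y + x) = \sum_(j < N.+1) w j.
  by rewrite conv_pow_cons.
rewrite -/f -/N mulr_sumr -sumrB.
pose E1 j := expR (- (u * (N%:R * f * (1 + delta)))) * expR (u * j%:R).
pose E2 j := expR (u * (N%:R * f * (1 - delta))) * expR (- u * j%:R).
have E10 j : 0 <= E1 j by rewrite mulr_ge0 ?expR_ge0.
have E20 j : 0 <= E2 j by rewrite mulr_ge0 ?expR_ge0.
apply: (@le_trans _ _ (\sum_(j < N.+1) (delta * f * w j + v j * E1 j + v j * E2 j))).
  apply: le_trans (ler_norm_sum _ _ _) _; apply: ler_sum => j _.
  rewrite -/(w j) -mulrBl normrM (ger0_norm (w0 _)).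
  have /(_ (isT))/(_ (ltn_ord j)) := frequency_deviation_le _ _ _ N j f01 u0 d0.
  move=> /(ler_wpM2r (w0 j)) /le_trans; apply.
  by rewrite !mulrDl lerD// ?lerD// mulrC ler_wpM2r.
rewrite !big_split /= -mulr_sumr addrAC -addrA lerD//.
  by rewrite mulrCA mulrA.
have Nf0 : 0 <= N%:R * f by rewrite mulr_ge0.
rewrite mulr_natl mulr2n lerD//.
  under eq_bigr do rewrite mulrCA.
  rewrite -mulr_sumr.
  apply: le_trans (ler_wpM2l _ (binomial_mgf_le _ _ _ f01)) _; first exact: expR_ge0.
  rewrite -expRD ler_expR.
  by have := ler_wpM2l Nf0 lo; lra.
under eq_bigr do rewrite mulrCA.
rewrite -mulr_sumr.
apply: le_trans (ler_wpM2l _ (binomial_mgf_le _ _ _ f01)) _; first exact: expR_ge0.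
rewrite -expRD ler_expR.
by have := ler_wpM2l Nf0 hi; lra.
Qed.

End Chernoff.

(** * Boxes and exponential tilting *)

Lemma Zd_ext {d} (x y : Zd d) :
  (forall j, (x : 'rV[int]_d) ord0 j = (y : 'rV[int]_d) ord0 j) -> x = y.
Proof. exact: (@rowP int d x y).1. Qed.

Section Box.
Context {d : nat}.

Definition box (N : nat) : seq (Zd d) :=
  [seq (\row_j ((f j : nat)%:Z - N%:Z) : 'rV[int]_d)
  | f : {ffun 'I_d -> 'I_(N.*2.+1)}].

Lemma size_box N : size (box N) = (N.*2.+1 ^ d)%N.
Proof. by rewrite size_map -cardE card_ffun !card_ord. Qed.

Lemma box_uniq N : uniq (box N).
Proof.
rewrite map_inj_uniq ?enum_uniq// => f g /rowP fg; apply/ffunP => j.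
by have := fg j; rewrite !mxE => /addIr [] /val_inj.
Qed.

Lemma mem_boxP N (y : Zd d) :
  reflect (forall j, (`|(y : 'rV[int]_d) ord0 j| <= N)%N) (y \in box N).
Proof.
apply: (iffP mapP) => [[f _ ->] j|yN].
  by rewrite mxE; case: (f j) => k kN /=; lia.
exists [ffun j => inord (absz ((y : 'rV[int]_d) ord0 j + N%:Z))].
  by rewrite mem_enum.
apply: Zd_ext => j; rewrite !mxE ffunE.
by case: (fun_of_matrix _ _ _) (yN j) => k kN; rewrite inordK; lia.
Qed.

Lemma sub_box M N : (M <= N)%N -> {subset box M <= box N}.
Proof.
by move=> MN y /mem_boxP yM; apply/mem_boxP => j; exact: leq_trans (yM j) MN.
Qed.

Lemma box_exhausts (y : Zd d) : \forall N \near \oo, y \in box N.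
Proof.
exists (\sum_j `|(y : 'rV[int]_d) ord0 j|)%N => //= N yN; apply/mem_boxP => j.
by apply: leq_trans yN; rewrite (bigD1 j)//= leq_addr.
Qed.

Lemma sub_box_seq (A : seq (Zd d)) : exists N, {subset A <= box N}.
Proof.
elim: A => [|a A [N AN]]; first by exists 0%N.
have [M _ aM] := box_exhausts a.
exists (maxn M N) => z; rewrite inE => /orP[/eqP ->|/AN].
  exact/aM/leq_maxl.
by apply: sub_box; exact: leq_maxr.
Qed.

End Box.

(** An exponential outgrows a power: e^(nh) >= (nh / (k+1))^(k+1). *)
Lemma exp_le_pow_le0 {R : realType} (h c : R) (k : nat) : 0 <= c ->
  (forall n : nat, (0 < n)%N -> expR (n%:R * h) <= c * n%:R ^+ k) -> h <= 0.
Proof.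
move=> c0 le_pow; rewrite leNgt; apply/negP => h0.
pose q := (h / k.+1%:R) ^+ k.+1.
have q0 : 0 < q by rewrite exprn_gt0// divr_gt0// ltr0n.
pose n := (Num.bound (c / q)).+1.
have ltn : c / q < n%:R.
  by rewrite (lt_trans (archi_boundP (divr_ge0 c0 (ltW q0))))// ltr_nat.
have n0 : 0 < n%:R :> R by rewrite ltr0n.
have := le_pow n isT; apply/negP; rewrite -ltNge.
apply: (@lt_le_trans _ _ (q * n%:R ^+ k.+1)).
  rewrite exprS mulrA ltr_pM2r ?exprn_gt0//.
  by rewrite mulrC -ltr_pdivrMr.
rewrite -exprMn (_ : n%:R * h = (h / k.+1%:R * n%:R) * k.+1%:R); last first.
  by rewrite mulrAC divfK ?pnatr_eq0// mulrC.
rewrite expRM_natr lerXn2r ?nnegrE ?expR_ge0//.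
  by rewrite mulr_ge0 ?divr_ge0 ?ler0n// ltW.
by apply: le_trans (expR_ge1Dx _); rewrite lerDr.
Qed.

Section Tilting.
Context {R : realType} {V : zmodType}.
Variables (F : V -> R) (t : V -> R).
Hypotheses (F0 : forall x, 0 <= F x) (tD : {morph t : x y / x + y}).

(** Multiplicativity of the Laplace transform. As [L] may be any list that
    carries the convolution power, its translate by a step is another such list,
    to which the induction hypothesis applies. *)
Lemma tilted_conv_pow (A L : seq V) n : uniq L ->
  (forall s, conv_pow F A n s != 0 -> s \in L) ->
  \sum_(s <- L) expR (t s) * conv_pow F A n s =
  (\sum_(a <- A) F a * expR (t a)) ^+ n.
Proof.
have t0 : t 0 = 0 by have := tD 0 0; rewrite addr0; lra.
elim: n L => [|n IHn] L uL supL.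
  rewrite (bigD1_seq 0)//= ?supL//= ?eqxx ?oner_eq0// t0 expR0 mulr1 expr0.
  by rewrite big1 ?addr0// => s /negPf ->; rewrite mulr0.
rewrite exprS mulr_suml /=.
under eq_bigr do rewrite mulr_sumr.
rewrite exchange_big /= [LHS]big_seq [RHS]big_seq; apply: eq_bigr => a aA.
have [Fa0|Fa0] := eqVneq (F a) 0.
  by rewrite Fa0 !mul0r big1// => s _; rewrite mul0r mulr0.
rewrite -(IHn [seq s - a | s <- L]); last 2 first.
- by rewrite map_inj_uniq//; exact: addIr.
- move=> s ns0; apply/mapP; exists (s + a); last by rewrite addrK.
  apply: supL; rewrite /= psumr_neq0 => [|z _]; last first.
    by rewrite mulr_ge0 ?conv_pow_ge0.
  apply/hasP; exists a => //=; rewrite addrK mulr_gt0// lt0r.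
    by rewrite Fa0 F0.
  by rewrite ns0 conv_pow_ge0.
rewrite big_map mulr_sumr; apply: eq_bigr => s _.
by rewrite -{1}(subrK a s) tD expRD; ring.
Qed.

End Tilting.

Lemma conv_pow_box {R : realType} {d} (F : Zd d -> R) (A : seq (Zd d)) N n s :
  {subset A <= box N} -> conv_pow F A n s != 0 -> s \in box (n * N).
Proof.
move=> AN; elim: n s => [|n IHn] s /=.
  by rewrite pnatr_eq0 eqb0 negbK => /eqP ->; apply/mem_boxP => j; rewrite mxE.
case: (boolP (has (fun a => conv_pow F A n (s - a) != 0) A)).
  move=> /hasP[a /AN /mem_boxP aN /IHn /mem_boxP saN] _.
  apply/mem_boxP => j; have := aN j; have := saN j; rewrite !mxE mulSn.
  by move: (fun_of_matrix s _ _) (fun_of_matrix a _ _) => u v; lia.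
move=> /hasPn noA; rewrite big_seq big1 ?eqxx// => a /noA.
by rewrite negbK => /eqP ->; rewrite mulr0.
Qed.

(** The n-th power of the tilted mass is spread over polynomially many points
    only, so that a mass larger than e^-a would violate the assumed bound for
    large n. *)
Lemma tilted_mass_le {R : realType} {d} (F : Zd d -> R) (t : Zd d -> R) (a : R)
    (A : seq (Zd d)) :
  (forall x, 0 <= F x) -> {morph t : x y / x + y} ->
  (forall n s, conv_pow F A n s <= expR (- (a * n%:R) - t s)) ->
  \sum_(x <- A) F x * expR (t x) <= expR (- a).
Proof.
move=> F0 tD le_p; set M := \sum_(x <- A) _.
have [->|M0] := eqVneq M 0; first exact: expR_ge0.
have {}M0 : 0 < M.
  by rewrite lt0r M0 sumr_ge0// => x _; rewrite mulr_ge0 ?expR_ge0.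
have [N AN] := sub_box_seq A.
suff : ln M + a <= 0 by move=> ?; rewrite -(lnK M0) ler_expR; lra.
apply: (@exp_le_pow_le0 _ _ (N.*2.+1%:R ^+ d) d) => [|n n0]; first exact: exprn_ge0.
rewrite mulrDr expRD expRM_natl (lnK M0).
rewrite -(tilted_conv_pow _ _ F0 tD A (box (n * N))); last 2 first.
- exact: box_uniq.
- by move=> s; exact: conv_pow_box.
rewrite mulr_suml.
apply: (@le_trans _ _ (\sum_(s <- box (n * N)) (1 : R))).
  apply: ler_sum => s _.
  apply: (@le_trans _ _ (expR (t s) * expR (- (a * n%:R) - t s) * expR (n%:R * a))).
    by rewrite ler_wpM2r ?expR_ge0// ler_wpM2l ?expR_ge0.
  by rewrite -!expRD -expR0 ler_expR; lra.
rewrite big_const_seq count_predT iter_addr addr0 size_box.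
rewrite natrX -exprMn -natrM lerXn2r ?nnegrE// ler_nat.
nia.
Qed.

(** * Tracking a direction by a semigroup *)

Section Inner.
Context {R : realType} {D : nat}.
Implicit Types u v w : 'rV[R]_D.

Lemma innerC u v : inner u v = inner v u.
Proof. by apply: eq_bigr => i _; rewrite mulrC. Qed.

Lemma innerDl u v w : inner (u + v) w = inner u w + inner v w.
Proof. by rewrite /inner -big_split; apply: eq_bigr => i _; rewrite mxE mulrDl. Qed.

Lemma innerZl (a : R) u v : inner (a *: u) v = a * inner u v.
Proof. by rewrite /inner mulr_sumr; apply: eq_bigr => i _; rewrite mxE mulrA. Qed.

Lemma innerNl u v : inner (- u) v = - inner u v.
Proof. by rewrite -scaleN1r innerZl mulN1r. Qed.

Lemma innerDr u v w : inner u (v + w) = inner u v + inner u w.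
Proof. by rewrite innerC innerDl !(innerC _ u). Qed.

Lemma innerNr u v : inner u (- v) = - inner u v.
Proof. by rewrite innerC innerNl innerC. Qed.

Lemma coord_le_norm u i : `|u ord0 i| <= `|u|.
Proof.
rewrite [leRHS]mx_normrE.
by apply: (le_bigmax _ (fun ij : 'I_1 * 'I_D => `|u ij.1 ij.2|) (ord0, i)).
Qed.

Lemma inner_le_norm u v : `|inner u v| <= D%:R * (`|u| * `|v|).
Proof.
apply: le_trans (ler_norm_sum _ _ _) _.
rewrite mulr_natl -[X in _ *+ X](card_ord D) -sumr_const.
by apply: ler_sum => i _; rewrite normrM ler_pM ?coord_le_norm.
Qed.

Lemma sqr_coord_le_inner u i : u ord0 i ^+ 2 <= inner u u.
Proof.
rewrite /inner (bigD1 i)//= expr2 lerDl.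
by apply: sumr_ge0 => j _; rewrite -expr2 sqr_ge0.
Qed.

Lemma inner_self_le u c : `|u| <= c -> inner u u <= D%:R * c ^+ 2.
Proof.
move=> uc; apply: le_trans (ler_norm _) (le_trans (inner_le_norm _ _) _).
by rewrite ler_wpM2l// expr2 ler_pM.
Qed.

Lemma inner_near u v e : 0 < e ->
  \forall u' \near u, `|inner u' v - inner u v| < e.
Proof.
move=> e0; pose c := D%:R * `|v| + 1.
have c0 : 0 < c by rewrite ltr_wpDl// mulr_ge0.
near=> u'.
rewrite -innerNl -innerDl; apply: le_lt_trans (inner_le_norm _ _) _.
have : `|u' - u| < e / c.
  rewrite distrC; near: u'.
  have idu : x @[x --> u] --> u by exact: cvg_id.
  by move/cvgr_dist_lt : idu; apply; rewrite divr_gt0.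
rewrite ltr_pdivlMr// => h; apply: le_lt_trans h.
by rewrite mulrCA ler_wpM2l// /c; lra.
Unshelve. all: end_near. Qed.

End Inner.

(** With [G] a set of available displacements and [v] a target direction, every
    unit direction [u] in which a residual may point admits a correction that
    shortens it substantially: either adding [v], or subtracting an element of
    [G]. The bounds on the size and on the first coordinate of that element are
    what [greedy] needs to stay bounded and to terminate. *)
Definition margin {R : realType} {D : nat} (G : set 'rV[R]_D.+1) v (eta : R) :=
  forall u, `|u| = 1 -> inner u v <= - eta \/
    exists g, [/\ G g, `|g| <= eta^-1, eta <= g ord0 ord0 & eta <= inner u g].

(** The unit sphere is compact, and the strict inequalities persist near a given
    [u] for small [eta]. *)
Lemma uniform_margin {R : realType} {D : nat} (G : set 'rV[R]_D.+1) v :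
  (forall u, u != 0 -> 0 <= inner u v ->
     exists g, [/\ G g, 0 < g ord0 ord0 & 0 < inner u g]) ->
  exists2 eta, 0 < eta & margin G v eta.
Proof.
move=> Gv.
pose P (eta : R) (u : 'rV[R]_D.+1) := inner u v <= - eta \/
    exists g, [/\ G g, `|g| <= eta^-1, eta <= g ord0 ord0 & eta <= inner u g].
have cpt : compact [set u : 'rV[R]_D.+1 | `|u| = 1].
  apply: bounded_closed_compact.
    by exists 1; split => // M M1 u /= ->; exact: ltW.
  have -> : [set u : 'rV[R]_D.+1 | `|u| = 1] = Num.norm @^-1` [set 1] by [].
  apply: closed_comp => [u _|]; [exact: norm_continuous|exact: closed_eq].
have PF : \forall eta \near 0^'+, [set u : 'rV[R]_D.+1 | `|u| = 1] `<=` P eta.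
  apply: ((compact_near_coveringP _).1 cpt R 0^'+ P _ _) => u /= u1.
  have u0 : u != 0 by rewrite -normr_eq0 u1 oner_eq0.
  have [uv|uv] := ltP (inner u v) 0.
    near=> u' eta => /=; left.
    have uu' : `|inner u' v - inner u v| < - inner u v / 2.
      by near: u'; apply: inner_near; lra.
    have : eta < - inner u v / 2 by near: eta; apply: nbhs_right_lt; lra.
    by move: uu'; rewrite ltr_norml; lra.
  have [g [Gg g0 ug]] := Gv u u0 uv.
  near=> u' eta => /=; right; exists g; split => //.
  - have : eta < (`|g| + 1)^-1.
      by near: eta; apply: nbhs_right_lt; rewrite invr_gt0 ltr_wpDl.
    have eta0 : 0 < eta by near: eta; exact: nbhs_right_gt.
    rewrite -[X in X < _]invrK ltf_pV2 ?posrE ?invr_gt0 ?ltr_wpDl// => ?.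
    lra.
  - by apply: ltW; near: eta; apply: nbhs_right_lt.
  - have uu' : `|inner u' g - inner u g| < inner u g / 2.
      by near: u'; apply: inner_near; lra.
    have : eta < inner u g / 2 by near: eta; apply: nbhs_right_lt; lra.
    by move: uu'; rewrite ltr_norml; lra.
near (0:R)^'+ => eta; exists eta; first by [].
move=> u u1; apply: (near PF eta) => //.
Unshelve. all: end_near. Qed.

Lemma margin_near {R : realType} {D : nat} (G : set 'rV[R]_D.+1) v v' eta :
  0 < eta -> D.+1%:R * `|v' - v| <= eta / 2 ->
  margin G v eta -> margin G v' (eta / 2).
Proof.
move=> eta0 vv' Gv u u1.
have uv' : inner u v' <= inner u v + eta / 2.
  rewrite -lerBlDl -innerNr -innerDr; apply: le_trans (ler_norm _) _.
  by apply: le_trans (inner_le_norm _ _) _; rewrite u1 mul1r.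
have [uv|[g [Gg g1 g0 ug]]] := Gv u u1; [left|right; exists g; split => //].
- by lra.
- by apply: le_trans g1 _; rewrite lef_pV2 ?posrE; lra.
- by lra.
- by lra.
Qed.

(** |r - w|^2 = |r|^2 - 2 <r, w> + |w|^2, where <r, w> is at least a fixed
    multiple of |r|. *)
Lemma margin_reduces {R : realType} {D : nat} (r w : 'rV[R]_D.+1) (eta c : R) :
  0 < eta -> 0 < `|r| -> `|w| <= c -> eta <= inner (`|r|^-1 *: r) w ->
  D.+1%:R * c ^+ 2 <= 2 * eta * `|r| ->
  inner (r - w) (r - w) <= inner r r.
Proof.
move=> eta0 r0 wc; rewrite innerZl mulrC ler_pdivlMr// => rw h.
have := inner_self_le _ _ wc.
by rewrite !(innerDl, innerDr, innerNl, innerNr) (innerC w r); lra.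
Qed.

(** The residual j v - h is corrected step by step: when it is long, the margin
    provides a step (adding [v], that is increasing [j], or adding an element of
    [G] to [h]) that does not lengthen it, and when it is short [j] is increased.
    Between two increments of [j] only finitely many elements of [G] are added,
    because each raises the first coordinate of [h] by at least [eta] while the
    residual stays bounded. The bound [B] does not depend on [v]. *)
Lemma greedy {R : realType} {D : nat} (G : set 'rV[R]_D.+1) (eta V : R) :
  0 < eta -> 0 <= V -> G 0 -> (forall g h, G g -> G h -> G (g + h)) ->
  exists2 B, 0 <= B & forall v, `|v| <= V -> margin G v eta ->
  forall j : nat, exists2 h, G h & inner (j%:R *: v - h) (j%:R *: v - h) <= B.
Proof.
move=> eta0 V0 G0 GD.
pose c := V + eta^-1.
have c0 : 0 < c by rewrite ltr_wpDl// invr_gt0.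
pose rho := D.+1%:R * c ^+ 2 / (2 * eta).
have rho0 : 0 < rho by rewrite divr_gt0 ?mulr_gt0 ?exprn_gt0.
pose B := D.+1%:R * (rho + c) ^+ 2.
have B0 : 0 <= B by rewrite mulr_ge0 ?sqr_ge0.
exists B => // v vV mv; elim=> [|j [h Gh hB]].
  by exists 0 => //; rewrite scale0r subrr /inner big1// => i _; rewrite mxE mul0r.
pose top := j%:R * v ord0 ord0 + B + 1.
have below h' : inner (j%:R *: v - h') (j%:R *: v - h') <= B -> h' ord0 ord0 <= top.
  move=> h'B; have := le_trans (sqr_coord_le_inner _ ord0) h'B.
  by rewrite !mxE /top => ?; nra.
have [m hm] : exists m : nat, top - h ord0 ord0 < m%:R * eta.
  exists (Num.bound ((top - h ord0 ord0) / eta)).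
  rewrite -ltr_pdivrMr//; apply: archi_boundP.
  by apply: divr_ge0; [rewrite subr_ge0; exact: below|exact: ltW].
(* [m] bounds the number of elements of [G] still to be added before [j] moves. *)
elim: m h Gh hB hm => [|m IHm] h Gh hB hm.
  by move: hm (below _ hB); rewrite mul0r; lra.
set r := j%:R *: v - h in hB.
have nextE : j.+1%:R *: v - h = r - (- v).
  by rewrite /r -natr1 scalerDl scale1r opprK addrAC.
have subE g : j%:R *: v - (h + g) = r - g by rewrite /r opprD addrA.
have [r_small|r_large] := leP `|r| rho.
  exists h => //; rewrite nextE opprK; apply: inner_self_le.
  apply: le_trans (ler_normD _ _) _; rewrite lerD// (le_trans vV)//.
  by rewrite /c lerDl invr_ge0 ltW.
have r0 : 0 < `|r| by exact: lt_trans r_large.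
have rc : D.+1%:R * c ^+ 2 <= 2 * eta * `|r|.
  by move: (ltW r_large); rewrite /rho ler_pdivrMr ?mulr_gt0// [_ * `|r|]mulrC.
have u1 : `| `|r|^-1 *: r| = 1.
  by rewrite normrZ normfV normr_id mulVf// gt_eqF.
have [uv|[g [Gg g1 g0 ug]]] := mv _ u1.
  exists h => //; rewrite nextE; apply: le_trans hB.
  apply: (@margin_reduces _ _ _ _ eta c) => //; last by rewrite innerNr lerNr.
  by rewrite normrN /c (le_trans vV)// lerDl invr_ge0 ltW.
apply: (IHm (h + g)); first exact: GD.
  rewrite subE; apply: le_trans hB.
  apply: (@margin_reduces _ _ _ _ eta c) => //.
  by apply: le_trans g1 _; rewrite /c lerDr.
by rewrite mxE; move: hm; rewrite -natr1; lra.
Qed.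

(** * Walks and aperiodicity *)

Section Words.
Context {d : nat}.
Variable S : set (Zd d).

Definition word (xs : seq (Zd d)) := forall x, x \in xs -> S x.

Lemma word_cat xs ys : word xs -> word ys -> word (xs ++ ys).
Proof. by move=> wx wy x; rewrite mem_cat => /orP[/wx|/wy]. Qed.

Lemma word_nseq n x : S x -> word (nseq n x).
Proof. by move=> Sx y /nseqP[->]. Qed.

(** The endpoints of pairs of words of equal length differ by a subgroup which
    contains all differences of steps, hence everything. The discrepancy [k] in
    length is then filled with copies of one step. *)
Lemma aperiodic_words (k : int) (y : Zd d) : S !=set0 ->
  smallest (@is_subgroup d) [set x - y | x in S & y in S] = [set: Zd d] ->
  exists xs ys, [/\ word xs, word ys, (size xs)%:Z = (size ys)%:Z + k
    & y = \sum_(x <- xs) x - \sum_(x <- ys) x].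
Proof.
move=> [x0 Sx0] aper.
pose H : set (Zd d) := [set y | exists xs ys, [/\ word xs, word ys,
   size xs = size ys & y = \sum_(x <- xs) x - \sum_(x <- ys) x]].
have HT z : H z.
  have : [set: Zd d] z by []. rewrite -aper; apply: smallest_sub.
    split.
      by exists [::], [::]; split => //; rewrite big_nil subrr.
    move=> _ _ [xs [ys [wx wy sxy ->]]] [xs' [ys' [wx' wy' sxy' ->]]].
    exists (xs ++ ys'), (ys ++ xs'); split.
      + by apply: word_cat.
      + by apply: word_cat.
      + by rewrite !size_cat sxy sxy'.
      + by rewrite !big_cat /= !opprD opprK [- (\sum_(x <- xs') x) + _]addrC addrACA.
  move=> _ [x Sx [x' Sx' <-]]; exists [:: x], [:: x'].
  by split; rewrite ?big_seq1// => z'; rewrite inE => /eqP ->.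
case: k => n.
  have [xs [ys [wx wy sxy e]]] := HT (y - x0 *+ n).
  exists (xs ++ nseq n x0), ys; split => //.
  - by apply: word_cat => //; exact: word_nseq.
  - by rewrite size_cat size_nseq sxy.
  - by rewrite big_cat /= big_nseq iter_addr_0 addrAC -e subrK.
have [xs [ys [wx wy sxy e]]] := HT (y + x0 *+ n.+1).
exists xs, (ys ++ nseq n.+1 x0); split => //.
- by apply: word_cat => //; exact: word_nseq.
- by rewrite size_cat size_nseq sxy; lia.
- by rewrite big_cat big_nseq iter_addr_0 opprD addrA -e addrK.
Qed.

End Words.

(** The law [p n] of the n-th position of a walk with step weights [F], seen
    through finite alphabets only, so that no convolution with infinitely many
    terms is ever formed. *)
Definition walk_law {R : realType} {d} (F : Zd d -> R) (p : nat -> Zd d -> R) :=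
  [/\ forall x, 0 <= F x,
      forall A, uniq A -> \sum_(a <- A) F a <= 1,
      forall A n y, uniq A -> conv_pow F A n y <= p n y
    & forall n y, conv_pow F (box N) n y @[N --> \oo] --> p n y].

Section WalkLaw.
Context {R : realType} {d : nat} {F : Zd d -> R} {p : nat -> Zd d -> R}.
Hypothesis Wp : walk_law F p.

Let F0 x : 0 <= F x. Proof. by case: Wp. Qed.
Let p_lim n y : conv_pow F (box N) n y @[N --> \oo] --> p n y.
Proof. by case: Wp. Qed.

Lemma walk_law_ge0 n y : 0 <= p n y.
Proof.
case: Wp => _ _ /(_ [::] n y isT) + _; apply: le_trans; exact: conv_pow_ge0.
Qed.

Lemma walk_law_le1 n y : p n y <= 1.
Proof.
apply: (cvgr_to_le (p_lim n y)); near=> N.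
apply: le_trans (conv_pow_le_mass _ _ _ _ F0) _.
by rewrite exprn_ile1 ?sumr_ge0//; case: Wp => _ /(_ _ (box_uniq N)).
Unshelve. all: end_near. Qed.

Lemma walk_law_supermult m n s t : p m s * p n t <= p (m + n) (s + t).
Proof.
apply: (ler_cvg_to (cvgM (p_lim m s) (p_lim n t)) (p_lim _ _)); near=> N.
exact: conv_pow_supermult.
Unshelve. all: end_near. Qed.

Lemma walk_law_start : p 0 0 = 1.
Proof.
apply/eqP; rewrite eq_le walk_law_le1 /=.
by case: Wp => _ _ /(_ [::] 0%N 0 isT) + _; rewrite /= eqxx.
Qed.

Lemma walk_law_cons x n y : F x * p n y <= p n.+1 (y + x).
Proof.
rewrite mulrC -addn1; apply: le_trans (walk_law_supermult _ _ _ _).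
rewrite ler_wpM2l ?walk_law_ge0//.
by case: Wp => _ _ /(_ [:: x] 1%N x isT) + _; rewrite /= big_seq1 subrr eqxx mulr1.
Qed.

Lemma walk_law_word xs : word [set x | 0 < F x] xs ->
  0 < p (size xs) (\sum_(x <- xs) x).
Proof.
elim: xs => [|x xs IHxs] wxs; first by rewrite big_nil walk_law_start.
rewrite big_cons addrC; apply: lt_le_trans (walk_law_cons _ _ _).
rewrite mulr_gt0 ?IHxs ?(wxs x) ?mem_head// => z zxs.
by apply: wxs; rewrite inE zxs orbT.
Qed.

(** [conv_pow_step] for the alphabets [box N], whose constants do not depend on
    [N], passes to the limit. *)
Lemma walk_law_step x delta : 0 < F x -> 0 < delta <= 1 ->
  exists2 c, 0 < c & forall n y,
    `|p n y - p n.+1 (y + x)|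
    <= delta * p n.+1 (y + x) + 2 / F x * expR (- (n%:R * c)).
Proof.
move=> Fx d01; have [u [kappa [u0 k0 hi lo]]] := chernoff_rate _ d01.
have /andP[d0 d1] := d01.
exists (F x * kappa); first exact: mulr_gt0.
move=> n y; rewrite -(ler_pM2l Fx).
apply: (@le_trans _ _ (F x * (delta * p n.+1 (y + x))
                       + 2 * expR (- (n.+1%:R * F x * kappa)))).
  apply: (@ler_cvg_to _ \oo _ _
     (fun N => F x * `|conv_pow F (box N) n y - conv_pow F (box N) n.+1 (y + x)|)
     (fun N => F x * (delta * conv_pow F (box N) n.+1 (y + x))
               + 2 * expR (- (n.+1%:R * F x * kappa)))).
  - by apply: cvgM; [exact: cvg_cst|apply: cvg_norm; apply: cvgB; exact: p_lim].
  - apply: cvgD; last exact: cvg_cst.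
    by do 2![apply: cvgM; first exact: cvg_cst]; exact: p_lim.
  near=> N.
  have xN : x \in box N by near: N; exact: box_exhausts.
  rewrite !(eq_perm_conv_pow _ _ _ _ _ (perm_to_rem xN)).
  apply: (conv_pow_step _ _ _ _ _ u) => //; last exact: ltW.
  by case: Wp => _ /(_ _ (box_uniq N)) + _ _; rewrite (big_rem x xN).
rewrite mulrDr lerD2l mulrA [F x * (2 / _)]mulrC divfK ?gt_eqF// ler_wpM2l//.
rewrite ler_expR lerN2 mulrA (ler_pM2r k0) (ler_pM2r Fx) ler_nat; exact: leqnSn.
Unshelve. all: end_near. Qed.

(** Each error (e, y) is a difference of two words. Putting the subtracted words
    of all errors into the reserve point (k0, w0) makes every corrected point
    the endpoint of a word, hence a point of positive probability. *)
Lemma walk_law_reserve : [set x | 0 < F x] !=set0 ->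
  smallest (@is_subgroup d)
    [set x - y | x in [set x | 0 < F x] & y in [set x | 0 < F x]] = [set: Zd d] ->
  forall L : seq (int * Zd d), exists k0 w0 c,
  [/\ 0 < c, c <= p k0 w0 & forall e, e \in L ->
    exists2 k : nat, k%:Z = k0%:Z + e.1 & c <= p k (w0 + e.2)].
Proof.
move=> Sn0 aper; elim=> [|[e y] L [k0 [w0 [c [c0 cp cL]]]]].
  by exists 0%N, 0, 1; split; rewrite ?walk_law_start.
have [xs [ys [wx wy sxy ->]]] := aperiodic_words _ e y Sn0 aper.
have px := walk_law_word _ wx; have py := walk_law_word _ wy.
pose c' := c * Num.min (p (size xs) (\sum_(x <- xs) x))
                       (p (size ys) (\sum_(x <- ys) x)).
have extend k w zs : c <= p k w ->
    c * p (size zs) (\sum_(x <- zs) x)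
    <= p (k + size zs) (w + \sum_(x <- zs) x).
  move=> cpk; apply: le_trans (walk_law_supermult _ _ _ _).
  by rewrite ler_wpM2r ?walk_law_ge0.
have c'x : c' <= c * p (size xs) (\sum_(x <- xs) x).
  by rewrite ler_pM2l// ge_min lexx.
have c'y : c' <= c * p (size ys) (\sum_(x <- ys) x).
  by rewrite ler_pM2l// ge_min lexx orbT.
exists (k0 + size ys)%N, (w0 + \sum_(x <- ys) x), c'; split.
- by rewrite mulr_gt0// lt_min px py.
- exact: le_trans c'y (extend _ _ _ cp).
move=> e'; rewrite inE => /orP[/eqP -> /=|/cL [k ke' ck]].
  exists (k0 + size xs)%N; first by lia.
  rewrite addrCA -addrA subrr addr0 -[X in p _ X]addrC.
  exact: le_trans c'x (extend _ _ _ cp).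
exists (k + size ys)%N; first by lia.
by rewrite addrAC; apply: le_trans c'y (extend _ _ _ ck).
Qed.

End WalkLaw.

(** * Subexponential decay of the probabilities along the sequence *)

Section SpaceTime.
Context {R : realType} {d : nat}.
Implicit Types (r a : R) (y : 'rV[R]_d).

(** The product of a cost axis, a time axis and space. The cost comes first since
    [margin] singles out the first coordinate. *)
Definition vec r a y : 'rV[R]_(1 + (1 + d)) := row_mx r%:M (row_mx a%:M y).

Lemma vec_cost r a y : vec r a y ord0 ord0 = r.
Proof.
rewrite (_ : ord0 = lshift (1 + d) (ord0 : 'I_1)); last exact: val_inj.
by rewrite row_mxEl mxE eqxx.
Qed.

Lemma vec_time r a y : vec r a y ord0 (rshift 1 (lshift d ord0)) = a.
Proof. by rewrite row_mxEr row_mxEl mxE eqxx. Qed.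

Lemma vec_space r a y j : vec r a y ord0 (rshift 1 (rshift 1 j)) = y ord0 j.
Proof. by rewrite !row_mxEr. Qed.

Lemma vec_surj (u : 'rV[R]_(1 + (1 + d))) : exists r a y, u = vec r a y.
Proof.
exists (u ord0 (lshift _ ord0)), (u ord0 (rshift 1 (lshift d ord0))),
  (rsubmx (rsubmx u)).
rewrite -[LHS]hsubmxK -[rsubmx u in LHS]hsubmxK /vec.
congr (row_mx _ (row_mx _ _)).
  by rewrite [LHS]mx11_scalar !mxE.
by rewrite [LHS]mx11_scalar !mxE.
Qed.

Lemma vec0 : vec 0 0 0 = 0.
Proof. by rewrite /vec !raddf0 !row_mx0. Qed.

Lemma vecD r a y r' a' y' : vec r a y + vec r' a' y' = vec (r + r') (a + a') (y + y').
Proof. by rewrite /vec 2!add_row_mx -!raddfD. Qed.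

Lemma vecN r a y : - vec r a y = vec (- r) (- a) (- y).
Proof. by rewrite /vec 2!opp_row_mx -!raddfN. Qed.

Lemma vecZ c r a y : c *: vec r a y = vec (c * r) (c * a) (c *: y).
Proof. by rewrite /vec 2!scale_row_mx !scale_scalar_mx. Qed.

Lemma inner_vec r a y r' a' y' :
  inner (vec r a y) (vec r' a' y') = r * r' + (a * a' + inner y y').
Proof.
rewrite /inner.
pose f (i : 'I_(1 + (1 + d))) := vec r a y 0 i * vec r' a' y' 0 i.
rewrite -[LHS]/(\sum_i f i) big_split_ord big_ord1 big_split_ord big_ord1 /f.
congr (_ * _ + (_ * _ + _)); rewrite ?vec_time//.
- by rewrite row_mxEl mxE eqxx.
- by rewrite row_mxEl mxE eqxx.
- by apply: eq_bigr => i _; rewrite !vec_space.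
Qed.

Lemma norm_vec_le r a y : `|vec r a y| <= `|r| + `|a| + `|y|.
Proof.
rewrite [leLHS]mx_normrE; apply/bigmax_leP; split => [|[i j] _].
  by rewrite !addr_ge0.
rewrite [i]ord1 /=.
case: (split_ordP j) => k ->.
  by rewrite row_mxEl mxE [k]ord1 eqxx mulr1n -addrA lerDl addr_ge0.
rewrite row_mxEr; case: (split_ordP k) => l ->.
  by rewrite row_mxEl mxE [l]ord1 eqxx mulr1n addrAC lerDr addr_ge0.
by rewrite row_mxEr (le_trans (coord_le_norm _ _))// lerDr addr_ge0.
Qed.

End SpaceTime.

Lemma Zd_to_RdD {R : realType} {d} : {morph @Zd_to_Rd R d : x y / x + y}.
Proof. by move=> x y; rewrite /Zd_to_Rd -map_mxD. Qed.

Lemma Zd_to_RdB {R : realType} {d} : {morph @Zd_to_Rd R d : x y / x - y}.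
Proof. by move=> x y; rewrite /Zd_to_Rd -map_mxB. Qed.

Lemma inner_Zd_eq0 {R : realType} {d} (theta : 'rV[R]_d) :
  (forall x : Zd d, inner theta (Zd_to_Rd R x) = 0) -> theta = 0.
Proof.
move=> all0; apply/rowP => j; rewrite mxE.
rewrite -(all0 (delta_mx 0 j : 'rV[int]_d)) /inner (bigD1 j)//= !mxE !eqxx.
rewrite mulr1 big1 ?addr0// => i ij.
by rewrite !mxE (negPf ij) andbF mulr0.
Qed.

(** The bound E[e^<theta, X>] <= c, in terms of finite sums. *)
Definition laplace_le {R : realType} {d} (F : Zd d -> R) (theta : 'rV[R]_d) (c : R) :=
  forall A : seq (Zd d), uniq A ->
    \sum_(x <- A) F x * expR (inner theta (Zd_to_Rd R x)) <= c.

(** The cost [r] is a budget for minus the logarithm of the probability, which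
    adds up under concatenation: supermultiplicativity of [p] makes this set a
    semigroup. *)
Definition affordable {R : realType} {d} (p : nat -> Zd d -> R) :
    set 'rV[R]_(1 + (1 + d)) :=
  [set g | exists r k z, g = vec r k%:R (Zd_to_Rd R z) /\ expR (- r) <= p k z].

Section Duality.
Context {R : realType} {d : nat} {F : Zd d -> R} {p : nat -> Zd d -> R}.
Hypothesis Wp : walk_law F p.
Let S : set (Zd d) := [set x | 0 < F x].
Hypothesis S_nonempty : S !=set0.
Hypothesis S_aperiodic :
  smallest (@is_subgroup d) [set x - y | x in S & y in S] = [set: Zd d].

Let F0 x : 0 <= F x. Proof. by case: Wp. Qed.
Let FS x : F x != 0 -> S x. Proof. by rewrite /S /= lt0r F0 andbT. Qed.

Lemma affordable0 : affordable p 0.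
Proof.
exists 0, 0%N, 0; split; last by rewrite oppr0 expR0 (walk_law_start Wp).
by rewrite /Zd_to_Rd map_mx0 vec0.
Qed.

Lemma affordableD g h : affordable p g -> affordable p h -> affordable p (g + h).
Proof.
move=> [r [k [z [-> rp]]]] [r' [k' [z' [-> rp']]]].
exists (r + r'), (k + k')%N, (z + z'); split.
  by rewrite vecD natrD Zd_to_RdD.
apply: le_trans (walk_law_supermult Wp _ _ _ _).
by rewrite opprD expRD ler_pM ?expR_ge0.
Qed.

(** If the walk stays in the half-space <theta, x> <= -a at each step, then it
    does not stay on its boundary: by aperiodicity some step [x1] of positive
    weight lies strictly inside, which lowers the Laplace transform. *)
Lemma laplace_strict (theta : 'rV[R]_d) (a : R) : theta != 0 ->
  (forall x, S x -> inner theta (Zd_to_Rd R x) <= - a) ->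
  exists2 gamma, gamma < - a & laplace_le F theta (expR gamma).
Proof.
move=> theta0 below.
have [x1 Sx1 x1a] : exists2 x, S x & inner theta (Zd_to_Rd R x) < - a.
  apply: contrapT => no_x; apply/negP: theta0; rewrite negbK; apply/eqP.
  apply: inner_Zd_eq0 => y.
  pose H : set (Zd d) := [set y | inner theta (Zd_to_Rd R y) = 0].
  suff : H y by [].
  have : [set: Zd d] y by []. rewrite -S_aperiodic; apply: smallest_sub.
    split => [|u v].
      rewrite /H /= /Zd_to_Rd map_mx0 /inner big1// => i _; by rewrite mxE mulr0.
    by rewrite /H /= Zd_to_RdB innerDr innerNr => -> ->; rewrite subrr.
  have on x : S x -> inner theta (Zd_to_Rd R x) = - a.
    move=> Sx; apply/eqP; rewrite eq_le below//= leNgt; apply/negP => xa.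
    by apply: no_x; exists x.
  by move=> _ [x Sx [x' Sx' <-]]; rewrite /H /= Zd_to_RdB innerDr innerNr !on// subrr.
have Fx1 : F x1 <= 1.
  by case: Wp => _ /(_ [:: x1] isT) + _ _; rewrite big_seq1.
pose q := F x1 * expR (inner theta (Zd_to_Rd R x1)) + expR (- a) * (1 - F x1).
have q0 : 0 < q.
  by rewrite ltr_pwDl ?mulr_gt0 ?expR_gt0// mulr_ge0 ?expR_ge0// subr_ge0.
exists (ln q).
  rewrite -ltr_expR (lnK q0) /q.
  move: x1a; rewrite -ltr_expR => x1a.
  by move: x1a; rewrite -(ltr_pM2l Sx1); lra.
have bound A : uniq (x1 :: A) ->
    \sum_(x <- x1 :: A) F x * expR (inner theta (Zd_to_Rd R x)) <= q.
  move=> uA; rewrite big_cons lerD2l.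
  have mA : \sum_(x <- A) F x <= 1 - F x1.
    by rewrite lerBrDl; case: Wp => _ /(_ _ uA) + _ _; rewrite big_cons.
  apply: le_trans (ler_wpM2l (expR_ge0 _) mA).
  rewrite mulr_sumr; apply: ler_sum => x _.
  have [->|/FS Sx] := eqVneq (F x) 0; first by rewrite mul0r mulr0.
  by rewrite mulrC ler_wpM2r// ler_expR below.
move=> A uA; rewrite (lnK q0).
have [x1A|x1A] := boolP (x1 \in A).
  rewrite (perm_big _ (perm_to_rem x1A)); apply: bound.
  by rewrite -(perm_uniq (perm_to_rem x1A)).
apply: (@le_trans _ _ (\sum_(x <- x1 :: A) F x * expR (inner theta (Zd_to_Rd R x)))).
  by rewrite big_cons lerDr mulr_ge0 ?expR_ge0.
by apply: bound; rewrite /= x1A.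
Qed.

(** The direction (eps, 1, x) is interior to the cone of affordable displacements
    when the conjugate of the log-Laplace transform vanishes at [x]. Otherwise a
    linear form (c, a, theta), nonnegative at this direction, is nonpositive on
    all affordable displacements. If c < 0, normalised to -1, this reads
    p k z <= e^(-a k - <theta, z>), so the log-Laplace transform at theta is at
    most -a, hence less than <theta, x>. If c = 0, each step satisfies
    <theta, z> <= -a <= <theta, x>, and [laplace_strict] applies. *)
Lemma affordable_dual (x : 'rV[R]_d) (eps : R) : 0 < eps ->
  (forall theta gamma, laplace_le F theta (expR gamma) -> inner theta x <= gamma) ->
  forall u, u != 0 -> 0 <= inner u (vec eps 1 x) ->
  exists g, [/\ affordable p g, 0 < g ord0 ord0 & 0 < inner u g].
Proof.
move=> eps0 psi0 u; have [c [a [theta ->]]] := vec_surj u.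
rewrite inner_vec mulr1 => u0 above; apply: contrapT => no_g.
have dual r k z : 0 < r -> expR (- r) <= p k z ->
    c * r + (a * k%:R + inner theta (Zd_to_Rd R z)) <= 0.
  move=> r0 rp; rewrite leNgt; apply/negP => neg; apply: no_g.
  exists (vec r k%:R (Zd_to_Rd R z)); rewrite vec_cost inner_vec; split => //.
  by exists r, k, z.
have c0 : c <= 0.
  have e1 : expR (- 1) <= p 0 0.
    by rewrite (walk_law_start Wp) -[leRHS]expR0 ler_expR lerN10.
  have := dual 1 0%N 0 ltr01 e1.
  rewrite /Zd_to_Rd map_mx0 mulr0 mulr1 /inner big1 ?addr0// => i _.
  by rewrite mxE mulr0.
have [c_lt0|c_ge0] := ltP c 0; last first.
  have {c0 c_ge0} c0 : c = 0 by apply/eqP; rewrite eq_le c0.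
  have below z : S z -> inner theta (Zd_to_Rd R z) <= - a.
    move=> Sz; have pz : 0 < p 1 z.
      have := walk_law_cons Wp z 0 0; rewrite (walk_law_start Wp) mulr1 add0r.
      exact: lt_le_trans.
    pose r := 1 - ln (p 1 z).
    have := dual r 1%N z; rewrite c0 mul0r add0r mulr1 => h.
    rewrite -subr_le0 opprK addrC; apply: h.
      have : ln (p 1 z) <= 0 by rewrite ln_le0// (walk_law_le1 Wp).
      by rewrite /r; lra.
    rewrite -[leRHS](lnK pz) ler_expR /r; lra.
  have [theta0|theta0] := eqVneq theta 0.
    have [z Sz] := S_nonempty; have := below _ Sz; move: above.
    have inner0 (w : 'rV[R]_d) : inner 0 w = 0.
      by rewrite /inner big1// => i _; rewrite mxE mul0r.
    move: u0; rewrite theta0 c0 !inner0 => /negP u0 above a0; apply: u0.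
    have -> : a = 0 by lra.
    by rewrite vec0.
  have [gamma gamma_a /psi0] := laplace_strict _ _ theta0 below.
  by move: above; rewrite c0; lra.
pose c' := - c; have c'0 : 0 < c' by rewrite oppr_gt0.
have cheb k z :
    p k z <= expR (- (a / c' * k%:R) - inner (c'^-1 *: theta) (Zd_to_Rd R z)).
  rewrite leNgt innerZl; apply/negP.
  set q := a / c' * k%:R + c'^-1 * inner theta (Zd_to_Rd R z).
  rewrite -opprD -/q => lt_p.
  have pk : 0 < p k z by apply: lt_trans lt_p; exact: expR_gt0.
  move: lt_p; rewrite -[X in _ < X](lnK pk) ltr_expR => lt_p.
  have lnp : ln (p k z) <= 0 by rewrite ln_le0// (walk_law_le1 Wp).
  (* A cost halfway between the true cost -ln p and the forbidden one q. *)
  have r0 : 0 < (q - ln (p k z)) / 2 by lra.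
  have rp : expR (- ((q - ln (p k z)) / 2)) <= p k z.
    by rewrite -[leRHS](lnK pk) ler_expR; lra.
  have := dual _ k z r0 rp.
  have -> : a * k%:R + inner theta (Zd_to_Rd R z) = c' * q.
    by rewrite /q; field; rewrite gt_eqF.
  have -> : c * ((q - ln (p k z)) / 2) + c' * q = c' * ((q + ln (p k z)) / 2).
    by rewrite /c'; lra.
  rewrite pmulr_rle0//; lra.
have : laplace_le F (c'^-1 *: theta) (expR (- (a / c'))).
  move=> A uA; apply: tilted_mass_le => //.
    by move=> y z; rewrite Zd_to_RdD innerDr.
  by move=> n z; apply: le_trans (cheb n z); case: Wp => _ _ /(_ A n z uA).
move=> /psi0; rewrite innerZl mulrC -mulNr ler_pM2r ?invr_gt0//.
have : 0 < c' * eps by rewrite mulr_gt0.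
by move: above; rewrite /c'; lra.
Qed.

End Duality.

Lemma int_norm_le {R : realType} (z : int) (B : R) (N : nat) :
  z%:~R ^+ 2 <= B -> B <= N%:R -> (`|z| <= N)%N.
Proof.
move=> zB BN.
have : (`|z| ^ 2)%:R <= N%:R :> R.
  apply: le_trans (le_trans zB BN).
  by rewrite natrX natr_absz intr_norm real_normK ?num_real.
rewrite ler_nat; apply: leq_trans.
by case: `|z|%N => // k; rewrite expnS leq_pmulr// expn1.
Qed.

Section Subexponential.
Context {R : realType} {d : nat} {F : Zd d -> R} {p : nat -> Zd d -> R}.
Hypothesis Wp : walk_law F p.
Let S : set (Zd d) := [set x | 0 < F x].
Hypothesis S_nonempty : S !=set0.
Hypothesis S_aperiodic :
  smallest (@is_subgroup d) [set x - y | x in S & y in S] = [set: Zd d].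

Let slope (s : nat -> Zd d) n : 'rV[R]_d := n%:R^-1 *: Zd_to_Rd R (s n).

(** The target n (eps/2, 1, s n / n), reduced by the reserve, is tracked by an
    affordable displacement up to a bounded error, by [greedy]. Its time and
    space components are integers, so this error takes finitely many values and
    is corrected from the reserve at a cost independent of [n]. The total cost
    is n eps/2 + O(1). *)
Lemma walk_law_subexp_near (s : nat -> Zd d) (x : 'rV[R]_d) (eps : R) : 0 < eps ->
  (forall theta gamma, laplace_le F theta (expR gamma) ->
     inner theta x <= gamma) ->
  \forall x' \near x & n \near \oo,
    slope s n = x' -> expR (- (eps * n%:R)) <= p n (s n).
Proof.
move=> eps0 psi0.
have eps2 : 0 < eps / 2 by rewrite divr_gt0.
pose v := vec (eps / 2) 1 x.
have [eta eta0 mv] := uniform_margin _ _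
  (affordable_dual Wp S_nonempty S_aperiodic x _ eps2 psi0).
have eta2 : 0 < eta / 2 by rewrite divr_gt0.
have V0 : 0 <= `|v| + 1 by rewrite addr_ge0.
have [B B0 greedyB] := greedy _ _ _ eta2 V0
  (affordable0 Wp) (affordableD Wp).
(* Bounds the coordinates of the error, integers whose squares are at most [B]. *)
have [N BN] : exists N : nat, B <= N%:R.
  by exists (Num.bound B); apply/ltW/archi_boundP.
pose L : seq (int * Zd d) :=
  [seq (e, y) | e <- [seq i%:Z - N%:Z | i <- iota 0 N.*2.+1], y <- box N].
have [k0 [w0 [c [c0 _ reserve]]]] := walk_law_reserve Wp S_nonempty S_aperiodic L.
pose D : R := (1 + (1 + d))%N%:R.
have D0 : 0 < D by rewrite ltr0n.
pose delta := Num.min 1 (eta / 2 / D).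
have delta0 : 0 < delta by rewrite lt_min ltr01 divr_gt0.
have small (a : R) : 0 <= a -> \forall n \near \oo, a / n%:R <= delta / 3.
  move=> a0; near=> n.
  have n0 : 0 < n%:R :> R by rewrite ltr0n; near: n; exists 1%N.
  rewrite ler_pdivrMr// mulrC -ler_pdivrMr; last by rewrite divr_gt0.
  apply/ltW; apply: lt_le_trans (archi_boundP _) _.
    by rewrite divr_ge0// divr_ge0// ltW.
  by rewrite ler_nat; near: n; exact: nbhs_infty_ge.
have x_near e : 0 < e -> \forall x' \near x, `|x - x'| <= e.
  have idx : x' @[x' --> x] --> x by exact: cvg_id.
  by move/cvgr_dist_le : idx; apply.
near=> x' n => /= xx'.
have n0 : 0 < n%:R :> R by rewrite ltr0n; near: n; exists 1%N.
(* The target minus the reserve, per unit of time. *)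
pose v' := vec (eps / 2) ((n%:R - k0%:R) / n%:R)
               (n%:R^-1 *: (Zd_to_Rd R (s n) - Zd_to_Rd R w0)).
have vv' : `|v' - v| <= delta.
  rewrite /v' /v vecN vecD subrr scalerBr -/(slope s n) xx'.
  apply: le_trans (norm_vec_le _ _ _) _.
  have h1 : k0%:R / n%:R <= delta / 3 by near: n; apply: small.
  have h2 : `|Zd_to_Rd R w0| / n%:R <= delta / 3 by near: n; apply: small.
  have h3 : `|x - x'| <= delta / 3.
    by near: x'; apply: x_near; lra.
  have -> : (n%:R - k0%:R) / n%:R - 1 = - (k0%:R / n%:R) :> R.
    by field; rewrite gt_eqF.
  rewrite normr0 add0r normrN ger0_norm; last by rewrite divr_ge0.
  have : `|x' - n%:R^-1 *: Zd_to_Rd R w0 - x| <= `|x - x'| + `|Zd_to_Rd R w0| / n%:R.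
    rewrite addrAC (distrC x) (le_trans (ler_normB _ _))// lerD2l normrZ.
    by rewrite ger0_norm ?invr_ge0// mulrC.
  lra.
have mv' : margin (affordable p) v' (eta / 2).
  apply: margin_near mv => //; rewrite mulrC -ler_pdivlMr//.
  by apply: le_trans vv' _; rewrite /delta ge_min lexx orbT.
have v'V : `|v'| <= `|v| + 1.
  rewrite -(subrK v v') addrC (le_trans (ler_normD _ _))// lerD2l.
  by apply: le_trans vv' _; rewrite /delta ge_min lexx.
have [h [r [k [z [-> rp]]]] hB] := greedyB v' v'V mv' n.
move: hB; rewrite vecZ vecN vecD.
have -> : n%:R * ((n%:R - k0%:R) / n%:R) - k%:R = (n%:Z - k0%:Z - k%:Z)%:~R :> R.
  by rewrite !rmorphB /=; field; rewrite gt_eqF.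
have -> : n%:R *: (n%:R^-1 *: (Zd_to_Rd R (s n) - Zd_to_Rd R w0)) - Zd_to_Rd R z
    = Zd_to_Rd R (s n - w0 - z).
  by rewrite scalerA divff ?gt_eqF// scale1r !Zd_to_RdB.
set e := (_ - _ - _)%R; set y := (_ - _ - _)%R; set residual := vec _ _ _ => hB.
have coordB i : residual ord0 i ^+ 2 <= B.
  exact: le_trans (sqr_coord_le_inner _ _) hB.
have eN : (`|e| <= N)%N.
  apply: (@int_norm_le R _ B) => //.
  by have := coordB (rshift 1 (lshift d ord0)); rewrite vec_time.
have yN : y \in box N.
  apply/mem_boxP => j; apply: (@int_norm_le R _ B) => //.
  by have := coordB (rshift 1 (rshift 1 j)); rewrite vec_space mxE.
have eyL : (e, y) \in L.
  apply/allpairsP; exists (e, y); split => //; apply/mapP.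
  exists (absz (e + N%:Z)); first by rewrite mem_iota; lia.
  by rewrite /=; lia.
have [k' kk' cp] := reserve _ eyL.
have nE : n = (k' + k)%N by move: kk'; rewrite /e /=; lia.
have sE : s n = (w0 + y) + z by rewrite /y -addrA subrK addrC subrK.
rewrite sE {2}nE; apply: le_trans (walk_law_supermult Wp _ _ _ _).
apply: (@le_trans _ _ (c * expR (- r))); last by rewrite ler_pM// ?expR_ge0 ?ltW.
have r_le : r <= n%:R * (eps / 2) + B + 1.
  by have := coordB ord0; rewrite vec_cost => ?; nra.
rewrite -(lnK c0) -expRD ler_expR.
have : B + 1 - ln c <= n%:R * (eps / 2).
  rewrite -ler_pdivrMr//; apply: le_trans (ler_norm _) _.
  apply: le_trans (ltW (archi_boundP (normr_ge0 _))) _.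
  by rewrite ler_nat; near: n; exact: nbhs_infty_ge.
by lra.
Unshelve. all: end_near. Qed.

(** Compactness: the slopes s n / n lie in a ball, and near each point [x] of it,
    either the conjugate vanishes at [x] and [walk_law_subexp_near] applies, or
    some theta separates the slopes from a neighbourhood of [x] for large [n]. *)
Lemma walk_law_subexp (s : nat -> Zd d) (A : R) :
  (forall n, (0 < n)%N -> `|slope s n| <= A) ->
  (forall theta gamma, laplace_le F theta (expR gamma) ->
     forall delta, 0 < delta ->
     \forall n \near \oo, inner theta (slope s n) <= gamma + delta) ->
  forall eps, 0 < eps -> \forall n \near \oo, expR (- (eps * n%:R)) <= p n (s n).
Proof.
move=> sA spsi eps eps0.
pose K := [set x : 'rV[R]_d | `|x| <= A].
have cpt : compact K.
  apply: bounded_closed_compact.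
    exists A; split => [|M AM x /= xA]; first exact: num_real.
    exact: le_trans xA (ltW AM).
  have -> : K = Num.norm @^-1` [set a | a <= A] by [].
  apply: closed_comp => [u _|]; [exact: norm_continuous|exact: closed_le].
pose good n x := slope s n = x -> expR (- (eps * n%:R)) <= p n (s n).
have PF : \forall n \near \oo, K `<=` good n.
  apply: ((compact_near_coveringP _).1 cpt nat \oo good _ _) => x Kx.
  have [psi0|] := pselect (forall theta gamma,
      laplace_le F theta (expR gamma) -> inner theta x <= gamma).
    exact: walk_law_subexp_near.
  move=> /existsNP[theta /existsNP[gamma /not_implyP[Ltheta /negP]]].
  rewrite -ltNge => gamma_lt.
  pose delta := (inner theta x - gamma) / 2.
  have delta0 : 0 < delta by rewrite /delta; lra.
  near=> x' n => /= xx'.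
  have : `|inner x' theta - inner x theta| < delta by near: x'; exact: inner_near.
  have : inner theta (slope s n) <= gamma + delta by near: n; exact: spsi.
  by rewrite xx' !(innerC _ theta) ltr_norml /delta; lra.
near=> n.
have n0 : (0 < n)%N by near: n; exists 1%N.
have KP : K `<=` good n by near: n; exact: PF.
exact: (KP _ (sA n n0)).
Unshelve. all: end_near. Qed.

End Subexponential.

(** * Ratios of probabilities *)

Lemma near_le_expR {R : realType} (K c : R) : 0 < c ->
  \forall n \near \oo, K <= expR (c * n%:R).
Proof.
move=> c0; near=> n; apply: le_trans (expR_ge1Dx _).
have : `|K| / c <= n%:R.
  apply: le_trans (ltW (archi_boundP _)) _; first by rewrite divr_ge0// ltW.
  by rewrite ler_nat; near: n; exact: nbhs_infty_ge.
rewrite ler_pdivrMr// mulrC => h.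
by apply: le_trans (ler_norm _) (le_trans h _); rewrite lerDr.
Unshelve. all: end_near. Qed.

Section Ratio.
Context {R : realType} {d : nat} {F : Zd d -> R} {p : nat -> Zd d -> R}.
Hypothesis Wp : walk_law F p.
Implicit Types (f g : nat -> nat) (t u : nat -> Zd d).

Definition subexp f t :=
  forall eps, 0 < eps -> \forall n \near \oo, expR (- (eps * n%:R)) <= p (f n) (t n).

Definition cofinite_time f := exists C, forall n, (n <= f n + C)%N.

Lemma subexp_gt0 f t : subexp f t -> \forall n \near \oo, 0 < p (f n) (t n).
Proof.
by move=> /(_ 1 ltr01); apply: filterS => n; apply: lt_le_trans; exact: expR_gt0.
Qed.

Lemma subexp_scale f t g u c : 0 < c -> subexp f t ->
  (\forall n \near \oo, c * p (f n) (t n) <= p (g n) (u n)) -> subexp g u.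
Proof.
move=> c0 ft le_gu eps eps0.
have eps2 : 0 < eps / 2 by rewrite divr_gt0.
near=> n.
have h1 : c * p (f n) (t n) <= p (g n) (u n) by near: n.
have h2 : expR (- (eps / 2 * n%:R)) <= p (f n) (t n) by near: n; exact: ft.
have h3 : c^-1 <= expR (eps / 2 * n%:R) by near: n; exact: near_le_expR.
apply: le_trans h1; apply: le_trans (ler_wpM2l (ltW c0) h2).
have -> : - (eps * n%:R) = - (eps / 2 * n%:R) - (eps / 2 * n%:R) by field.
rewrite expRD mulrC ler_wpM2r ?expR_ge0// expRN -[leRHS]invrK.
by rewrite lef_pV2 ?posrE ?invr_gt0 ?expR_gt0.
Unshelve. all: end_near. Qed.

(** The error term of [walk_law_step] is negligible against the denominator,
    which decays subexponentially. *)
Lemma ratio_step f t x : 0 < F x -> cofinite_time f ->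
  subexp (fun n => (f n).+1) (fun n => t n + x) ->
  p (f n) (t n) / p (f n).+1 (t n + x) @[n --> \oo] --> (1 : R).
Proof.
move=> Fx [C fC] sub; apply/cvgrPdist_le => e e0.
have e2 : 0 < e / 2 by rewrite divr_gt0.
pose delta := Num.min 1 (e / 2).
have delta01 : 0 < delta <= 1 by rewrite lt_min ltr01 e2/= ge_min lexx.
have [c c0 step] := walk_law_step Wp x delta Fx delta01.
have c2 : 0 < c / 2 by rewrite divr_gt0.
pose K := 2 / F x * expR (C%:R * c).
have K0 : 0 < K by rewrite mulr_gt0 ?expR_gt0 ?divr_gt0.
near=> n.
have b_ge : expR (- (c / 2 * n%:R)) <= p (f n).+1 (t n + x) by near: n; exact: sub.
have K_le : K / (e / 2) <= expR (c / 2 * n%:R) by near: n; exact: near_le_expR.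
set a := p _ (t n); set b := p _ (t n + x) in b_ge *.
have b0 : 0 < b by apply: lt_le_trans b_ge; exact: expR_gt0.
rewrite -(divff (lt0r_neq0 b0)) -mulrBl normrM distrC [ `|b^-1| ]gtr0_norm ?invr_gt0//.
rewrite ler_pdivrMr//; apply: le_trans (step _ _) _; rewrite -/b.
have tail : 2 / F x * expR (- ((f n)%:R * c)) <= e / 2 * b.
  apply: (@le_trans _ _ (K * expR (- (c * n%:R)))).
    rewrite /K -[leRHS]mulrA -expRD ler_wpM2l ?ler_expR ?divr_ge0//; first exact: ltW.
    have : n%:R <= (f n)%:R + C%:R :> R by rewrite -natrD ler_nat.
    by move=> /(ler_wpM2r (ltW c0)); lra.
  apply: le_trans (ler_wpM2l (ltW e2) b_ge).
  have -> : - (c * n%:R) = c / 2 * n%:R * - 1 - (c / 2 * n%:R) by field.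
  rewrite expRD mulrA ler_wpM2r ?expR_ge0// mulrN1 expRN.
  by rewrite ler_pdivrMr ?expR_gt0// mulrC -ler_pdivrMr.
have de : delta * b <= e / 2 * b by rewrite (ler_pM2r b0) /delta ge_min lexx orbT.
lra.
Unshelve. all: end_near. Qed.

(** Steps are removed one at a time from the end point: a ratio tending to 1 also
    carries subexponential decay back from the denominator to the numerator. *)
Lemma ratio_word f t xs : word [set x | 0 < F x] xs -> cofinite_time f ->
  subexp (fun n => (f n + size xs)%N) (fun n => t n + \sum_(x <- xs) x) ->
  subexp f t /\
  p (f n) (t n) / p (f n + size xs)%N (t n + \sum_(x <- xs) x)
    @[n --> \oo] --> (1 : R).
Proof.
elim: xs f t => [|x xs IHxs] f t wxs cf.
  rewrite big_nil /=.
  under eq_fun do rewrite addn0.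
  under [X in subexp _ X]eq_fun do rewrite addr0.
  move=> sub; split => //.
  apply/cvgrPdist_le => e e0; near=> n.
  have p0 : 0 < p (f n) (t n) by near: n; exact: subexp_gt0.
  by rewrite addn0 addr0 divff ?gt_eqF// subrr normr0 ltW.
have Fx : 0 < F x by apply: wxs; exact: mem_head.
have {}wxs : word [set x | 0 < F x] xs.
  by move=> y yxs; apply: wxs; rewrite inE yxs orbT.
under eq_fun do rewrite /= addnS -addSn.
under [X in subexp _ X]eq_fun do rewrite big_cons addrA.
move=> sub; have [|sub1 ratio1] :=
  IHxs (fun n => (f n).+1) (fun n => t n + x) wxs _ sub.
  by have [C fC] := cf; exists C => n; rewrite addSn leqW.
have ratio := ratio_step f t x Fx cf sub1.
split.
  apply: (@subexp_scale _ _ _ _ 2^-1 _ sub1) => //.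
  near=> n.
  have b0 : 0 < p (f n).+1 (t n + x) by near: n; exact: subexp_gt0 sub1.
  have : 2^-1 <= p (f n) (t n) / p (f n).+1 (t n + x).
    near: n; apply: (cvgr_ge (1 : R)) => //; lra.
  by rewrite ler_pdivlMr.
rewrite -[1 : R]mulr1; apply: cvg_trans (cvgM ratio ratio1).
apply: near_eq_cvg; near=> n.
have b0 : 0 < p (f n).+1 (t n + x) by near: n; exact: subexp_gt0 sub1.
by rewrite /= big_cons addrA addnS -addSn mulrA divfK ?gt_eqF.
Unshelve. all: end_near. Qed.

(** Write (m, b) as the difference of two words of steps, [xs] minus [ys]. Both
    (n, s n) and (n - m, s n - b) reach the same point, the first by appending
    [ys] and the second by appending [xs], so that both probabilities are
    compared with the one at that common point. *)
Lemma ratio_limit (s : nat -> Zd d) (m : nat) (b : Zd d) :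
  [set x | 0 < F x] !=set0 ->
  smallest (@is_subgroup d)
    [set x - y | x in [set x | 0 < F x] & y in [set x | 0 < F x]] = [set: Zd d] ->
  subexp id s ->
  p (n - m)%N (s n - b) / p n (s n) @[n --> \oo] --> (1 : R).
Proof.
move=> Sn0 aper sub_s.
have [xs [ys [wx wy sxy bE]]] := aperiodic_words _ m%:Z b Sn0 aper.
pose g n := (n + size ys)%N; pose u n := s n + \sum_(y <- ys) y.
have sub_gu : subexp g u.
  apply: (@subexp_scale _ _ _ _ _ (walk_law_word Wp _ wy) sub_s).
  by apply: nearW => n; rewrite mulrC; exact: (walk_law_supermult Wp).
have [|_ down] := ratio_word id s ys wy _ sub_gu.
  by exists 0%N => n; rewrite addn0.
pose f n := (n - m)%N; pose t n := s n - b.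
have fgE : \forall n \near \oo, (f n + size xs)%N = g n.
  by exists m => // n /= mn; rewrite /f /g; lia.
have tuE n : t n + \sum_(x <- xs) x = u n.
  by rewrite /t /u bE opprB addrA subrK.
have [||_ up] := ratio_word f t xs wx.
- by exists m => n; rewrite /f; lia.
- move=> eps eps0; near=> n.
  have -> : (f n + size xs)%N = g n by near: n.
  by rewrite tuE; near: n; exact: sub_gu.
rewrite -[1 : R]divr1; apply: cvg_trans (cvgM up (cvgV (oner_neq0 _) down)).
apply: near_eq_cvg; near=> n.
have b0 : 0 < p (g n) (u n) by near: n; exact: subexp_gt0.
have e : (f n + size xs)%N = g n by near: n.
by rewrite /= tuE e invf_div mulrA divfK ?gt_eqF.
Unshelve. all: end_near. Qed.

End Ratio.

(** * From random variables to convolution powers *)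

Lemma measure_bigsetU_seq {R : realType} {dT} {T : measurableType dT} {V : choiceType}
    (mu : {measure set T -> \bar R}) (A : seq V) (E : V -> set T) :
  uniq A -> (forall a, measurable (E a)) ->
  (forall a b t, E a t -> E b t -> a = b) ->
  mu (\big[setU/set0]_(a <- A) E a) = (\sum_(a <- A) mu (E a))%E.
Proof.
move=> + mE E_inj; elim: A => [|a A IHA]; first by rewrite !big_nil measure0.
move=> /= /andP[aA uA]; rewrite !big_cons measureU//; first by congr adde; exact: IHA.
  by apply: bigsetU_measurable => b _.
apply/seteqP; split => // t [Eat]; rewrite -bigcup_seq => -[b /= bA Ebt].
by move: aA; rewrite (E_inj _ _ _ Eat Ebt) bA.
Qed.

Lemma norm_le_norm1 {R : realType} {d} (y : 'rV[R]_d) : `|y| <= norm1 y.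
Proof.
rewrite [leLHS]mx_normrE; apply/bigmax_leP; split => [|[i j] _].
  exact: sumr_ge0.
by rewrite [i]ord1 /norm1 (bigD1 j)//= lerDl sumr_ge0.
Qed.

Section Pmf.
Context {R : realType} {d : nat} (F : probability (Zd d) R).

Definition pmf (x : Zd d) : R := fine (F [set x]).

Lemma pmfE x : F [set x] = (pmf x)%:E.
Proof. by rewrite /pmf fineK// fin_num_measure. Qed.

Lemma pmf_ge0 x : 0 <= pmf x.
Proof. by rewrite -lee_fin -pmfE. Qed.

Lemma pmf_mass_le1 (A : seq (Zd d)) : uniq A -> \sum_(a <- A) pmf a <= 1.
Proof.
move=> uA; rewrite -lee_fin -sumEFin.
under eq_bigr do rewrite -pmfE.
rewrite -(measure_bigsetU_seq _ _ _ uA) => //; last by move=> a b t -> ->.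
exact: probability_le1.
Qed.

Lemma supp_pmf : supp F = [set x | 0 < pmf x].
Proof. by apply/seteqP; split => x; rewrite /supp /= pmfE lte_fin. Qed.

(** The expectation is the limit of its restrictions to boxes. *)
Lemma log_laplace_le theta gamma : laplace_le pmf theta (expR gamma) ->
  (log_laplace F theta <= gamma%:E)%E.
Proof.
move=> Lg; rewrite /log_laplace -(expeRK gamma%:E) lee_lne; last 2 first.
- by rewrite in_itv /= leey andbT; apply: expectation_ge0 => x; exact: expR_ge0.
- by rewrite in_itv /= leey lee_fin expR_ge0.
rewrite unlock.
pose h (x : Zd d) := expR (inner theta (Zd_to_Rd R x)).
have nd : {homo (fun N => \big[setU/set0]_(a <- @box d N) [set a]) :
    n m / (n <= m)%N >-> (n <= m)%O}.
  move=> n m nm; apply/subsetPset => x; rewrite -!bigcup_seq => -[a /= an ->].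
  by exists a => //=; exact: sub_box an.
have all_x : \bigcup_N \big[setU/set0]_(a <- @box d N) [set a] = [set: Zd d].
  apply/seteqP; split => // x _; have [N _ xN] := box_exhausts x.
  by exists N => //; rewrite -bigcup_seq; exists x => //; exact: (xN N (leqnn N)).
have lim : (\int[F]_(x in \big[setU/set0]_(a <- @box d N) [set a]) (h x)%:E)%E
    @[N --> \oo] --> (\int[F]_x (h x)%:E)%E.
  rewrite -all_x; apply: ge0_nondecreasing_set_cvg_integral => // N x _.
  by rewrite lee_fin expR_ge0.
have int1 a : (\int[F]_(x in [set a]) (h x)%:E)%E = (pmf a * h a)%:E.
  rewrite (eq_integral (cst (h a)%:E)); last by move=> x; rewrite inE => ->.
  rewrite integral_cst// mulrC EFinM; congr (_ * _)%E; exact: pmfE.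
apply: (cvge_to_le lim); near=> N.
rewrite ge0_integral_bigsetU//=.
- rewrite (eq_bigr _ (fun a _ => int1 a)).
  by rewrite sumEFin lee_fin; apply: Lg; exact: box_uniq.
- exact: box_uniq.
- by move=> a b _ _ [t [-> ->]].
- by move=> x _; rewrite lee_fin expR_ge0.
Unshelve. all: end_near. Qed.

Lemma conjugate_ge theta gamma x : laplace_le pmf theta (expR gamma) ->
  ((inner theta x - gamma)%:E <= conjugate F x)%E.
Proof.
move=> /log_laplace_le phi_le.
apply: (@le_trans _ _ ((inner theta x)%:E - log_laplace F theta)%E).
  by rewrite EFinB leeB.
apply: ereal_sup_ubound; exists theta => //.
by apply: le_lt_trans phi_le _; exact: ltry.
Qed.

End Pmf.

Section PartialSums.
Context {R : realType} {d : nat} {F : probability (Zd d) R}.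
Context {dT : measure_display} {T : measurableType dT} {P : probability T R}.
Variable X : nat -> {RV P >-> Zd d}.
Hypothesis X_indep : independent_RVs [set l | (1 <= l)%N] X.
Hypothesis X_law : forall l : nat, (1 <= l)%N -> distribution P (X l) =1 F.

(** Prescribing the future steps [bs] is what makes the induction on [n] go
    through: the last of the n+1 steps moves to the head of [bs], and
    independence is used only once, for n = 0. *)
Definition path_event (A : seq (Zd d)) n y (bs : seq (Zd d)) : set T :=
  [set t | [/\ partial_sum X n t = y,
    forall i, (1 <= i <= n)%N -> X i t \in A
    & forall i, (i < size bs)%N -> X (n + i).+1 t = nth 0 bs i]].

Lemma path_event0 A bs : path_event A 0 0 bs =
  \bigcap_(i in [set` [fset i | i in iota 1 (size bs)]%fset])
    (X i @^-1` [set nth 0 bs i.-1]).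
Proof.
apply/seteqP; split => [t [_ _ Xbs] i /=|t Xbs].
  rewrite !inE /= mem_iota => /andP[i1 ibs].
  by rewrite -[i in X i](prednK i1) -[i.-1]add0n Xbs//; lia.
split; first by rewrite /partial_sum big_geq.
  by move=> i; lia.
move=> i ibs; apply: (Xbs i.+1); rewrite /= !inE mem_iota; lia.
Qed.

Lemma path_eventS A n y bs : path_event A n.+1 y bs =
  \big[setU/set0]_(a <- A) path_event A n (y - a) (a :: bs).
Proof.
rewrite -bigcup_seq; apply/seteqP; split => [t [Sy XA Xbs]|t [a /= aA [Sy XA Xbs]]].
  exists (X n.+1 t); first by apply: XA; rewrite /= leqnn.
  split.
  - by rewrite -Sy /partial_sum [in RHS]big_nat_recr//= addrK.
  - by move=> i /andP[i1 iN]; apply: XA; rewrite i1 leqW.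
  - by move=> [|i] /= ibs; [rewrite addn0|rewrite addnS -addSn Xbs].
have Xa : X n.+1 t = a by have := Xbs 0%N isT; rewrite addn0.
split.
- rewrite /partial_sum big_nat_recr//= Xa.
  by move: Sy; rewrite /partial_sum => ->; rewrite subrK.
- move=> i /andP[i1]; rewrite leq_eqVlt => /orP[/eqP ->|iN]; first by rewrite Xa.
  by apply: XA; rewrite i1.
- by move=> i ibs; have := Xbs i.+1 ibs; rewrite /= addnS addSn.
Qed.

Lemma path_event_measurable A n y bs : measurable (path_event A n y bs).
Proof.
elim: n y bs => [|n IHn] y bs; last first.
  by rewrite path_eventS; apply: bigsetU_measurable.
have [->|y0] := eqVneq y 0.
  rewrite path_event0; apply: fin_bigcap_measurable => // i _.
  by rewrite -[_ @^-1` _]setTI; exact: measurable_funPT.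
rewrite (_ : path_event _ _ _ _ = set0)//; apply/seteqP; split => // t [].
by rewrite /partial_sum big_geq// => y0'; rewrite y0' eqxx in y0.
Qed.

Lemma path_event_prob A n y bs : uniq A ->
  P (path_event A n y bs) = (conv_pow (pmf F) A n y * \prod_(b <- bs) pmf F b)%:E.
Proof.
move=> uA; elim: n y bs => [|n IHn] y bs.
  have [->|y0] := eqVneq y 0; last first.
    rewrite /= (negPf y0) mul0r (_ : path_event _ _ _ _ = set0) ?measure0//.
    apply/seteqP; split => // t [].
    by rewrite /partial_sum big_geq// => y0'; rewrite y0' eqxx in y0.
  rewrite path_event0 X_indep//; last first.
    by move=> i /=; rewrite !inE mem_iota => /andP[].
  rewrite (perm_big (iota 1 (size bs))) /=; last first.
    apply: uniq_perm; rewrite ?iota_uniq ?fset_uniq// => i; by rewrite !inE.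
  rewrite eqxx mul1r -prodEFin [RHS](big_nth 0) /index_iota subn0.
  rewrite -[1%N]addn0 iotaDl. rewrite big_map; apply: eq_bigr => i _.
  by rewrite -pmfE -(X_law i.+1).
rewrite path_eventS measure_bigsetU_seq//; last 2 first.
- by move=> a; exact: path_event_measurable.
- move=> a b t [_ _ Xa] [_ _ Xb].
  by have := Xa 0%N isT; rewrite (Xb 0%N isT).
rewrite (eq_bigr _ (fun a _ => IHn (y - a) (a :: bs))).

rewrite sumEFin /= mulr_suml; congr EFin; apply: eq_bigr => a _.
by rewrite big_cons; ring.
Qed.

Lemma partial_sum_bigcup n y :
  [set t | partial_sum X n t = y] = \bigcup_N path_event (box N) n y [::].
Proof.
apply/seteqP; split => [t /= Sy|t [N _ [Sy _ _]]//].
have [N AN] := sub_box_seq [seq X i t | i <- iota 1 n].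
exists N => //; split => // i iN; apply: AN; apply/mapP; exists i => //.
by rewrite mem_iota; lia.
Qed.

Lemma partial_sum_measurable n y : measurable [set t | partial_sum X n t = y].
Proof.
rewrite partial_sum_bigcup; apply: bigcupT_measurable => N.
exact: path_event_measurable.
Qed.

Lemma partial_sum_walk_law :
  walk_law (pmf F) (fun n y => fine (P [set t | partial_sum X n t = y])).
Proof.
split.
- exact: pmf_ge0.
- exact: pmf_mass_le1.
- move=> A n y uA; rewrite -lee_fin fineK ?fin_num_measure//; last first.
    exact: partial_sum_measurable.
  have := path_event_prob A n y [::] uA; rewrite big_nil mulr1 => <-.
  apply: le_measure; rewrite ?inE.
  + exact: path_event_measurable.
  + exact: partial_sum_measurable.
  + by move=> t [].
- move=> n y.
  have := @nondecreasing_cvg_mu _ _ _ P (fun N => path_event (box N) n y [::]).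
  rewrite -partial_sum_bigcup => /(_ _ _ _) lim.
  have {}lim : P (path_event (box N) n y [::]) @[N --> \oo] -->
      P [set t | partial_sum X n t = y].
    apply: lim => [N||]; first exact: path_event_measurable.
      exact: partial_sum_measurable.
    move=> M N MN; apply/subsetPset => t [Sy XM _]; split => // i /XM.
    exact: sub_box.
  have e : (fun N => conv_pow (pmf F) (box N) n y) =
      (fun N => fine (P (path_event (box N) n y [::]))).
    by apply/funext => N; rewrite path_event_prob ?box_uniq//= big_nil mulr1.
  rewrite e; apply: fine_cvg; rewrite fineK// fin_num_measure//.
  exact: partial_sum_measurable.
Qed.

End PartialSums.

Theorem theorem4p7 (R : realType) (d : nat) (d_ge1 : (1 <= d)%N)
    (F : probability (Zd d) R) (aperF : aperiodic F)
    (dT : measure_display) (T : measurableType dT) (P : probability T R)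
    (X : nat -> {RV P >-> Zd d})
    (X_indep : independent_RVs [set l | (1 <= l)%N] X)
    (X_law : forall l : nat, (1 <= l)%N -> distribution P (X l) =1 F)
    (s : nat -> Zd d)
    (s_bounded :
      (ereal_sup [set (norm1 (n%:R^-1 *: Zd_to_Rd R (s n)))%:E
                 | n in [set n : nat | (1 <= n)%N]] < +oo)%E)
    (s_conj :
      conjugate F (n%:R^-1 *: Zd_to_Rd R (s n)) @[n --> \oo] --> 0%E)
    (m : nat) (b : Zd d) :
  (fine (P [set t | partial_sum X (n - m) t = s n - b]) /
   fine (P [set t | partial_sum X n t = s n])) @[n --> \oo] --> (1 : R).
Proof.
have Wp := partial_sum_walk_law X X_indep X_law.
have slopes theta gamma : laplace_le (pmf F) theta (expR gamma) ->
    forall delta, 0 < delta ->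
    \forall n \near \oo, inner theta (n%:R^-1 *: Zd_to_Rd R (s n)) <= gamma + delta.
  move=> Lg delta delta0.
  have : \forall n \near \oo,
      (conjugate F (n%:R^-1 *: Zd_to_Rd R (s n)) < delta%:E)%E.
    exact: (s_conj _ (@nbhs_open_ereal_lt R 0 (fun=> delta) delta0)).
  apply: filterS => n /(le_lt_trans (conjugate_ge F theta gamma _ Lg)).
  by rewrite lte_fin; lra.
(* With no step at all, the Laplace transform would vanish, and the conjugate
   would be infinite. *)
have supp0 : [set x | 0 < pmf F x] !=set0.
  apply: contrapT => no_x.
  have L0 : laplace_le (pmf F) 0 (expR (- 1)).
    move=> A _; rewrite big1 ?expR_ge0// => x _.
    have [->|x0] := eqVneq (pmf F x) 0; first by rewrite mul0r.
    by case: no_x; exists x; rewrite /= lt0r x0 pmf_ge0.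
  have half0 : 0 < 2^-1 :> R by rewrite invr_gt0.
  have [n _ /(_ n (leqnn n))] := slopes _ _ L0 2^-1 half0.
  rewrite /= /inner big1; first by lra.
  by move=> i _; rewrite mxE mul0r.
move: aperF; rewrite /aperiodic supp_pmf => aper.
have [A sA] : exists A : R, forall n, (0 < n)%N ->
    `|n%:R^-1 *: Zd_to_Rd R (s n)| <= A.
  pose x n := n%:R^-1 *: Zd_to_Rd R (s n).
  have sup_ge n : (0 < n)%N -> ((norm1 (x n))%:E <=
      ereal_sup [set (norm1 (x n))%:E | n in [set n : nat | (1 <= n)%N]])%E.
    by move=> n0; apply: ereal_sup_ubound; exists n.
  move: s_bounded sup_ge; rewrite -/(x _); case: (ereal_sup _) => [A _|//|_] sup_ge.
    by exists A => n /sup_ge; rewrite lee_fin; apply: le_trans; exact: norm_le_norm1.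
  by exists 0 => n /sup_ge; rewrite leeNy_eq.
apply: (ratio_limit Wp s m b supp0 aper).
exact: (walk_law_subexp Wp supp0 aper s A sA slopes).
Qed.
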